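(* Let $h(z)=zp(z)$ be analytic on $\mathbb{D}$, where $p$ is analytic on $\mathbb{D}$ and $\mathrm{Re}(p)>0$. Let $w_t$ be the solution to the Loewner ordinary differential equation $$\frac{d}{dt}w_t(z)=-w_t(z)\,p(w_t(z))$$ on $[a,\infty)$ with initial condition $w_a(z)=w(z)$, where $w:\mathbb{D}\to\mathbb{D}$ is univalent and $w(0)=0$, $0<w'(0)<1$. Then the power matrix of $w_t$ is given by $$[w_t]=\exp\big(-(t-a)\langle zp\rangle\big)\,[w_a].$$ In particular, the first $n$ coefficients of $w_t$ form the first row of the $(1,n)$ principal block of $\exp(-(t-a)\langle zp\rangle)[w_a]$.
   Context: $\mathbb{D}$ is the open unit disc; univalent means holomorphic and injective. Matrices are doubly infinite, indexed by $\mathbb{Z}\times\mathbb{Z}$; $A^m_n$ is the entry in row $m$, column $n$. For $f(z)=\sum_{k\ge1}a_kz^k$ with $a_1\neq0$, the power matrix $[f]$ has entries given by $f(z)^n=\sum_{k\geq n}[f]^n_kz^k$, $n\in\mathbb{Z}$. For $h(z)=\sum_{k\ge1}h_kz^k$, $\langle h\rangle$ is the matrix with entry $m\,h_{n-m+1}$ in row $m$, column $n$ ($h_j=0$ for $j\le0$); $\langle zp\rangle$ is this matrix for $h(z)=zp(z)$. $\exp$ is the entrywise matrix exponential (all matrices are upper triangular, so products are finite sums and the exponential converges entrywise). The $(m,n)$ principal block of $A$ is the matrix of entries $A^i_j$ with $m\le i\le n$, $m\le j\le n$. *)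

(* Defs.v *)
(* Stdlib reals with Coquelicot: complex numbers are Coquelicot's [C]. *)
From Stdlib Require Import Reals ZArith.
From Coquelicot Require Import Coquelicot.
Open Scope C_scope.

Definition in_disc (z : C) : Prop := (Cmod z < 1)%R.

Definition holomorphic_on_disc (f : C -> C) : Prop :=
  forall z : C, in_disc z -> @ex_derive C_AbsRing C_NormedModule f z.

Definition univalent_on_disc (f : C -> C) : Prop :=
  holomorphic_on_disc f /\
  forall z1 z2 : C, in_disc z1 -> in_disc z2 -> f z1 = f z2 -> z1 = z2.

(* [c] is the sequence of Taylor coefficients of [f] at 0.  Convergence on some
   neighbourhood of 0 is enough to determine [c]. *)
Definition is_taylor (f : C -> C) (c : nat -> C) : Prop :=
  exists r : R, (0 < r)%R /\
    forall z : C, (Cmod z < r)%R ->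
      @is_pseries C_AbsRing C_NormedModule c z (f z).

(* Integer powers.  For negative exponents this is the true power only at
   [z <> 0]. *)
Definition Cpowz (z : C) (n : Z) : C :=
  match n with
  | Z0 => 1
  | Zpos k => Cpow z (Pos.to_nat k)
  | Zneg k => / Cpow z (Pos.to_nat k)
  end.

(* Doubly infinite matrices: [A i j] is the entry in row [i], column [j]. *)
Definition zmatrix : Type := Z -> Z -> C.

Definition zm_one : zmatrix := fun i j => if Z.eqb i j then 1 else 0.

Definition zm_scal (c : C) (A : zmatrix) : zmatrix := fun i j => c * A i j.

(* Product of upper triangular matrices: only the indices [i <= k <= j] can
   contribute to the entry (i, j) of the product, the sum over [k] being written
   with [k = i + l]. *)
Definition zm_mul (A B : zmatrix) : zmatrix := fun i j =>
  if Z.leb i j then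
    @sum_n C_AbelianMonoid
      (fun l : nat => A i (i + Z.of_nat l)%Z * B (i + Z.of_nat l)%Z j)
      (Z.to_nat (j - i))
  else 0.

Fixpoint zm_pow (A : zmatrix) (k : nat) : zmatrix :=
  match k with
  | O => zm_one
  | S k' => zm_mul A (zm_pow A k')
  end.

Definition CSeries (u : nat -> C) : C :=
  (Series (fun k => Re (u k)), Series (fun k => Im (u k))).

Definition zm_exp (A : zmatrix) : zmatrix := fun i j =>
  CSeries (fun k : nat => zm_pow A k i j / RtoC (INR (fact k))).

(* The (m, n) principal block; its rows and columns are renumbered from 0. *)
Definition principal_block (m n : Z) (A : zmatrix) :
    matrix (Z.to_nat (n - m + 1)) (Z.to_nat (n - m + 1)) :=
  mk_matrix _ _ (fun i j : nat => A (m + Z.of_nat i)%Z (m + Z.of_nat j)%Z).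

(* [A] is the power matrix of f(z) = a_1 z + a_2 z^2 + ... with a_1 <> 0.  The
   expansion of f^n for n < 0 is the Laurent expansion at 0, which converges on
   a punctured disc where [f] has no zero; hence the radius [r]. *)
Definition is_power_matrix (f : C -> C) (A : zmatrix) : Prop :=
  f 0 = 0 /\
  A 1%Z 1%Z <> 0 /\
  (forall n k : Z, (k < n)%Z -> A n k = 0) /\
  exists r : R, (0 < r)%R /\
    forall (n : Z) (z : C), (0 < Cmod z < r)%R ->
      @is_series C_AbsRing C_NormedModule
        (fun j : nat =>
           A n (n + Z.of_nat j)%Z * Cpowz z (n + Z.of_nat j)%Z)
        (Cpowz (f z) n).

(* The matrix <h>, for h(z) = sum_(k >= 1) h_k z^k with coefficients [h]. *)
Definition angle (h : nat -> C) : zmatrix := fun m n =>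
  let j := (n - m + 1)%Z in
  if Z.leb j 0 then 0 else RtoC (IZR m) * h (Z.to_nat j).

(* [w] solves dw/dt = - w p(w) on [a, +oo), for every starting point of the
   disc; the derivative in [t] is taken within [a, +oo), so it is one-sided at
   [t = a]. *)
Definition loewner_solution (p : C -> C) (a : R) (w0 : C -> C)
    (w : R -> C -> C) : Prop :=
  (forall z : C, in_disc z -> w a z = w0 z) /\
  (forall (t : R) (z : C), (a <= t)%R -> in_disc z -> in_disc (w t z)) /\
  (forall (t : R) (z : C), (a <= t)%R -> in_disc z ->
     @filterdiff R_AbsRing R_NormedModule C_R_NormedModule
       (fun s : R => w s z)
       (within (fun s : R => (a <= s)%R) (locally t))
       (fun u : R => @scal R_AbsRing C_R_NormedModule u
                       (- (w t z * p (w t z))))).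

(* Main.v *)
(** Since Re p > 0, |w_t(z)| decreases in t, so for z near 0 the trajectory u(t) = w_t(z)
    stays where the Taylor series of h(z) = z p(z) converges and never reaches 0.
    Its powers v_n = u^n, n in Z, then solve the infinite triangular linear system
    v' = -<h> v.  To see that v(t) = exp(-(t-a)<h>) v(a), truncate: for
    E_s = exp(-(t-s)<h>), the finite sum over k in [n, n+m] of (E_s)^n_k u(s)^k equals
    u(t)^n at s = t, is a partial sum of the wanted series at s = a, and has an
    s-derivative consisting only of tails of the series of h; a geometric bound on the
    entries of E_s, with a ratio independent of the row, makes it tend to 0 with m.
    Substituting u(a)^k = w_a(z)^k = sum_j [w_a]^k_j z^j gives the product of matrices;
    the double series converges absolutely because the rows k >= 1 of [w_a] are
    convolution powers of row 1. *)

Require Import Defs.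
From Stdlib Require Import Reals ZArith Lia Lra.
From Coquelicot Require Import Coquelicot.
Open Scope C_scope.

Set Bullet Behavior "Strict Subproofs".

(** * Complex sums and series *)

(** A power matrix must come with one radius that serves all its rows, negative ones included. Every
    estimate is therefore split into a constant that may depend on the row n and a geometric ratio
    that may not, and the radius is fixed before n. For exp(x<h>) the row factor in <h> reaches |n|
    + e at offset e from the diagonal, so the entries grow like exp(2c|x|(|n| + e)) (2b)^e; only
    exp(2c|x||n|) is charged to the constant, which leaves the ratio 2b exp(2c|x|). Hence the radius
    obtained shrinks as t grows. For n < 0 the powers of u are bounded only while |u| stays away
    from 0. Injectivity of w makes u start away from 0, and a bound for |p| near 0 keeps it away on
    [a, t] by a Gronwall argument. The caps 1/4 and 1/8 on ratios leave room to absorb factors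
    linear in m through m + 1 <= 2^m. *)

Notation csum := (@sum_n C_AbelianMonoid).
Notation cseries := (@is_series C_AbsRing C_NormedModule).

(* [sum_n] types its equations in [AbelianMonoid.sort C_AbelianMonoid], which [ring]
   does not recognise as [C]. *)
Ltac cring :=
  match goal with |- @eq _ ?x ?y => change (@eq C x y) end; ring.

Lemma csum_S (f : nat -> C) (n : nat) : (csum f (S n) : C) = csum f n + f (S n).
Proof. exact (sum_Sn f n). Qed.

Lemma csum_plus (f g : nat -> C) (n : nat) :
  (csum (fun k => f k + g k) n : C) = csum f n + csum g n.
Proof. exact (sum_n_plus f g n). Qed.

Lemma csum_mult_l (c : C) (f : nat -> C) (n : nat) :
  (csum (fun k => c * f k) n : C) = c * csum f n.
Proof. exact (@sum_n_mult_l C_Ring c f n). Qed.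

Lemma csum_mult_r (c : C) (f : nat -> C) (n : nat) :
  (csum (fun k => f k * c) n : C) = csum f n * c.
Proof. exact (@sum_n_mult_r C_Ring c f n). Qed.

Lemma csum_re (f : nat -> C) (n : nat) : Re (csum f n) = sum_n (fun k => Re (f k)) n.
Proof.
induction n as [|n IH].
- now rewrite !sum_O.
- rewrite csum_S, sum_Sn, re_plus, IH. reflexivity.
Qed.

Lemma csum_im (f : nat -> C) (n : nat) : Im (csum f n) = sum_n (fun k => Im (f k)) n.
Proof.
induction n as [|n IH].
- now rewrite !sum_O.
- rewrite csum_S, sum_Sn, im_plus, IH. reflexivity.
Qed.

Lemma sum_n_le_loc (f g : nat -> R) (n : nat) :
  (forall k, (k <= n)%nat -> (f k <= g k)%R) -> (sum_n f n <= sum_n g n)%R.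
Proof.
induction n as [|n IH]; intros H.
- rewrite !sum_O. apply H; lia.
- rewrite !sum_Sn. apply Rplus_le_compat; [apply IH; intros; apply H; lia | apply H; lia].
Qed.

Lemma sum_n_Rmult_l (c : R) (f : nat -> R) (n : nat) :
  sum_n (fun k => c * f k)%R n = (c * sum_n f n)%R.
Proof. exact (@sum_n_mult_l R_Ring c f n). Qed.

Lemma csum_mod_le (f : nat -> C) (n : nat) :
  (Cmod (csum f n) <= sum_n (fun k => Cmod (f k)) n)%R.
Proof.
induction n as [|n IH].
- rewrite !sum_O. apply Rle_refl.
- rewrite csum_S, sum_Sn.
  eapply Rle_trans; [apply Cmod_triangle | now apply Rplus_le_compat_r].
Qed.

Lemma csum_mod_bound (f : nat -> C) (g : nat -> R) (n : nat) :
  (forall k, (k <= n)%nat -> (Cmod (f k) <= g k)%R) ->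
  (Cmod (csum f n) <= sum_n g n)%R.
Proof.
intros H. eapply Rle_trans; [apply csum_mod_le | now apply sum_n_le_loc].
Qed.

(** Both sides run over the pairs (i, d) with i + d <= m, grouped by i + d or by i. This regrouping
    is behind associativity, the cancellation in the flow and the double series. *)
Lemma csum_triangle (a : nat -> nat -> C) (m : nat) :
  (csum (fun j => csum (fun i => a i (j - i)%nat) j) m : C) =
  csum (fun i => csum (a i) (m - i)) m.
Proof.
induction m as [|m IH].
- now rewrite !sum_O.
- rewrite csum_S, IH, !csum_S, Cplus_assoc, <- csum_plus.
  replace (S m - S m)%nat with 0%nat by lia. rewrite sum_O. f_equal.
  apply sum_n_ext_loc; intros k Hk.
  replace (S m - k)%nat with (S (m - k)) by lia. now rewrite csum_S.
Qed.

Lemma cseries_lim (u : nat -> C) (l : C) :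
  cseries u l <-> is_lim_seq (fun n => Cmod (csum u n - l)) 0.
Proof.
pose proof (@filterlim_locally_ball_norm C_AbsRing nat C_NormedModule
  eventually _ (csum u) l) as E.
split.
- intros H0. pose proof (proj1 E H0) as H. apply (proj1 (is_lim_seq_spec _ _)). intros eps.
  destruct (H eps) as [N HN]. exists N. intros n Hn.
  specialize (HN n Hn). unfold ball_norm in HN.
  rewrite Rminus_0_r, Rabs_pos_eq by apply Cmod_ge_0. exact HN.
- intros H. apply (proj2 E). intros eps. apply (proj2 (is_lim_seq_spec _ _)) in H. destruct (H eps) as [N HN].
  exists N. intros n Hn. specialize (HN n Hn).
  rewrite Rminus_0_r, Rabs_pos_eq in HN by apply Cmod_ge_0. exact HN.
Qed.

Lemma cseries_le (u : nat -> C) (l : C) (e : nat -> R) :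
  (forall n, (Cmod (csum u n - l) <= e n)%R) -> is_lim_seq e 0 -> cseries u l.
Proof.
intros H He. apply cseries_lim.
apply is_lim_seq_le_le with (fun _ => 0%R) e; trivial.
- intros n; split; [apply Cmod_ge_0 | apply H].
- apply is_lim_seq_const.
Qed.

Lemma cseries_ext (u v : nat -> C) (l : C) :
  (forall n, u n = v n) -> cseries u l -> cseries v l.
Proof. intros H. now apply is_series_ext. Qed.

Lemma cseries_mult_l (c : C) (u : nat -> C) (l : C) :
  cseries u l -> cseries (fun n => c * u n) (c * l).
Proof. exact (@is_series_scal C_AbsRing C_NormedModule c u l). Qed.

Lemma cseries_plus (u v : nat -> C) (k l : C) :
  cseries u k -> cseries v l -> cseries (fun n => u n + v n) (k + l).
Proof. exact (@is_series_plus C_AbsRing C_NormedModule u v k l). Qed.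

Lemma Cmod_Ci : Cmod Ci = 1%R.
Proof.
unfold Cmod, Ci; simpl. replace (0 * (0 * 1) + 1 * (1 * 1))%R with 1%R by ring.
apply sqrt_1.
Qed.

Lemma im_le_Cmod (z : C) : (Rabs (Im z) <= Cmod z)%R.
Proof.
replace (Im z) with (Re (- Ci * z)) by (rewrite re_mult; simpl; ring).
eapply Rle_trans; [apply re_le_Cmod|].
rewrite Cmod_mult, Cmod_opp.
rewrite Cmod_Ci. lra.
Qed.

Lemma Cmod_le_re_im (z : C) : (Cmod z <= Rabs (Re z) + Rabs (Im z))%R.
Proof.
replace z with (RtoC (Re z) + Ci * RtoC (Im z)) at 1
  by (destruct z; unfold Ci, RtoC, Cplus, Cmult; simpl; f_equal; ring).
eapply Rle_trans; [apply Cmod_triangle|].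
rewrite Cmod_mult, !Cmod_R.
rewrite Cmod_Ci. lra.
Qed.

Lemma cseries_components (u : nat -> C) (l : C) :
  cseries u l <-> is_series (fun n => Re (u n)) (Re l) /\ is_series (fun n => Im (u n)) (Im l).
Proof.
split.
- intros H. apply cseries_lim in H.
  pose proof (proj2 (is_lim_seq_spec _ _) H) as H'.
  split; [change (is_lim_seq (sum_n (fun n => Re (u n))) (Re l))
         |change (is_lim_seq (sum_n (fun n => Im (u n))) (Im l))];
  apply (proj1 (is_lim_seq_spec _ _));
  intros eps; destruct (H' eps) as [N HN]; exists N; intros n Hn; specialize (HN n Hn);
  rewrite Rminus_0_r, Rabs_pos_eq in HN by apply Cmod_ge_0;
  (eapply Rle_lt_trans; [|exact HN]).
  + rewrite <- csum_re. exact (re_le_Cmod (csum u n - l)).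
  + rewrite <- csum_im. exact (im_le_Cmod (csum u n - l)).
- intros [HR HI].
  apply cseries_le with (fun n => Rabs (sum_n (fun n => Re (u n)) n - Re l) +
                               Rabs (sum_n (fun n => Im (u n)) n - Im l))%R.
  + intros n. eapply Rle_trans; [apply Cmod_le_re_im|].
    rewrite <- csum_re, <- csum_im. apply Req_le. reflexivity.
  + replace (Finite 0) with (Rbar_plus (Finite 0) (Finite 0)) by (simpl; f_equal; ring).
    assert (Z : forall (v : nat -> R) (m : R), is_series v m ->
              is_lim_seq (fun n => Rabs (sum_n v n - m)) 0).
    { intros v m Hv. replace 0%R with (Rabs (m - m)) by (rewrite Rminus_diag; apply Rabs_R0).
      apply is_lim_seq_abs with (l := Finite (m - m)).
      apply is_lim_seq_minus'; [exact Hv | apply is_lim_seq_const]. }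
    apply is_lim_seq_plus'; apply Z; assumption.
Qed.

Lemma cseries_unique (u : nat -> C) (k l : C) : cseries u k -> cseries u l -> k = l.
Proof.
intros Hk Hl. apply cseries_components in Hk, Hl.
destruct Hk as [Hk1 Hk2], Hl as [Hl1 Hl2].
apply is_series_unique in Hk1, Hk2, Hl1, Hl2.
destruct k, l; simpl in *; congruence.
Qed.

(** [CSeries] is a total function; a summable majorant is what makes its value the sum. *)
Lemma CSeries_correct (u : nat -> C) (g : nat -> R) :
  (forall n, (Cmod (u n) <= g n)%R) -> ex_series g -> cseries u (CSeries u).
Proof.
intros H Hg. apply cseries_components. split; simpl; apply Series_correct;
apply (@ex_series_le R_AbsRing R_CompleteNormedModule _ g); trivial;
intros n; (eapply Rle_trans; [|apply H]).
- apply re_le_Cmod.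
- apply im_le_Cmod.
Qed.

Lemma cseries_mod_le (u : nat -> C) (l : C) (B : R) :
  cseries u l -> (forall n, (Cmod (csum u n) <= B)%R) -> (Cmod l <= B)%R.
Proof.
intros H HB. apply cseries_lim in H.
apply (is_lim_seq_le (fun _ => Cmod l) (fun n => Cmod (csum u n - l) + B)%R (Cmod l) B).
- intros n. replace l with (- (csum u n - l) + csum u n) at 1 by ring.
  eapply Rle_trans; [apply Cmod_triangle|]. rewrite Cmod_opp.
  specialize (HB n); lra.
- apply is_lim_seq_const.
- replace (Finite B) with (Finite (0 + B)) by (f_equal; ring).
  apply is_lim_seq_plus'; [exact H | apply is_lim_seq_const].
Qed.

(** Restricting to q <= 1/2 replaces 1/(1 - q) by the constant 2, the source of the factors 2 in
    later bounds. *)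
Lemma sum_n_geom_le (q : R) (n : nat) :
  (0 <= q <= / 2)%R -> (sum_n (fun k => q ^ k) n <= 2)%R.
Proof.
intros Hq. enough (sum_n (fun k => q ^ k) n * (1 - q) <= 1)%R.
{ assert (H0 : (0 <= sum_n (fun k => q ^ k) n)%R).
  { rewrite sum_n_Reals. apply cond_pos_sum. intros k; apply pow_le; lra. }
  nra. }
assert (E : (sum_n (fun k => q ^ k) n * (1 - q) = 1 - q ^ S n)%R).
{ induction n as [|n IH]; [rewrite sum_O; simpl; ring|].
  rewrite sum_Sn. change (@plus R_AbelianMonoid) with Rplus.
  rewrite Rmult_plus_distr_r, IH; simpl; ring. }
rewrite E. assert (0 <= q ^ S n)%R by (apply pow_le; lra). lra.
Qed.

Lemma cseries_tail (u : nat -> C) (l : C) (A q : R) (m : nat) :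
  cseries u l -> (0 <= A)%R -> (0 <= q <= / 2)%R ->
  (forall k, (m < k)%nat -> (Cmod (u k) <= A * q ^ k)%R) ->
  (Cmod (l - csum u m) <= 2 * A * q ^ S m)%R.
Proof.
intros H HA Hq Hu.
assert (H' : cseries (fun k => u (S m + k)%nat) (l - csum u m)).
{ apply (@is_series_incr_n C_AbsRing C_NormedModule u (S m)); [lia|].
  replace (plus _ _) with l; [exact H|].
  change (l = (l - csum u m) + csum u m). ring. }
eapply cseries_mod_le; [exact H'|]. intros n.
apply Rle_trans with (sum_n (fun k => (A * q ^ S m) * q ^ k)%R n).
- apply csum_mod_bound. intros k _.
  eapply Rle_trans; [apply Hu; lia|]. rewrite pow_add. apply Req_le; ring.
- rewrite sum_n_Rmult_l.
  pose proof (sum_n_geom_le q n Hq).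
  assert (0 <= A * q ^ S m)%R by (apply Rmult_le_pos; [lra | apply pow_le; lra]).
  replace (2 * A * q ^ S m)%R with (A * q ^ S m * 2)%R by ring.
  now apply Rmult_le_compat_l.
Qed.

(** * Complex functions of a real variable *)

(** Taken componentwise so that the real mean value theorem and real power series apply to each
    component. *)
Definition is_cderive (f : R -> C) (x : R) (l : C) : Prop :=
  is_derive (fun s => Re (f s)) x (Re l) /\ is_derive (fun s => Im (f s)) x (Im l).

Lemma is_derive_eq (f : R -> R) (x l l' : R) : l = l' -> is_derive f x l -> is_derive f x l'.
Proof. now intros ->. Qed.

Lemma is_cderive_eq (f : R -> C) (x : R) (l l' : C) :
  l = l' -> is_cderive f x l -> is_cderive f x l'.
Proof. now intros ->. Qed.

Lemma is_cderive_ext (f g : R -> C) (x : R) (l : C) :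
  (forall s, f s = g s) -> is_cderive f x l -> is_cderive g x l.
Proof.
intros H [H1 H2]; split;
[apply is_derive_ext with (2 := H1) | apply is_derive_ext with (2 := H2)];
intros s; now rewrite H.
Qed.

Lemma is_cderive_const (c : C) (x : R) : is_cderive (fun _ => c) x 0.
Proof. split; apply (@is_derive_const R_AbsRing R_NormedModule). Qed.

Lemma is_cderive_plus (f g : R -> C) (x : R) (k l : C) :
  is_cderive f x k -> is_cderive g x l -> is_cderive (fun s => f s + g s) x (k + l).
Proof.
intros [F1 F2] [G1 G2]; split.
- exact (is_derive_plus _ _ _ _ _ F1 G1).
- exact (is_derive_plus _ _ _ _ _ F2 G2).
Qed.

Lemma is_cderive_csum (f : nat -> R -> C) (x : R) (l : nat -> C) (n : nat) :
  (forall k, (k <= n)%nat -> is_cderive (f k) x (l k)) ->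
  is_cderive (fun s => csum (fun k => f k s) n) x (csum l n).
Proof.
induction n as [|n IH]; intros H.
- rewrite sum_O. apply is_cderive_ext with (2 := H 0%nat ltac:(lia)).
  intros s; now rewrite sum_O.
- rewrite csum_S.
  apply is_cderive_ext with (fun s => csum (fun k => f k s) n + f (S n) s).
  { intros s; now rewrite csum_S. }
  apply is_cderive_plus; [apply IH; intros; apply H; lia | apply H; lia].
Qed.

Lemma is_cderive_mult (f g : R -> C) (x : R) (k l : C) :
  is_cderive f x k -> is_cderive g x l ->
  is_cderive (fun s => f s * g s) x (k * g x + f x * l).
Proof.
intros [F1 F2] [G1 G2].
assert (M : forall (a b : R -> R) (y z : R), is_derive a x y -> is_derive b x z ->
  is_derive (fun s => a s * b s)%R x (y * b x + a x * z)%R).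
{ intros a b y z Ha Hb. apply (is_derive_mult a b); trivial. intros; apply Rmult_comm. }
split.
- apply is_derive_eq with
    ((Re k * Re (g x) + Re (f x) * Re l) - (Im k * Im (g x) + Im (f x) * Im l))%R.
  { rewrite re_plus, !re_mult. ring. }
  apply is_derive_ext with (fun s => Re (f s) * Re (g s) - Im (f s) * Im (g s))%R.
  { intros; now rewrite re_mult. }
  apply (@is_derive_minus R_AbsRing R_NormedModule); now apply M.
- apply is_derive_eq with
    ((Re k * Im (g x) + Re (f x) * Im l) + (Im k * Re (g x) + Im (f x) * Re l))%R.
  { rewrite im_plus, !im_mult. ring. }
  apply is_derive_ext with (fun s => Re (f s) * Im (g s) + Im (f s) * Re (g s))%R.
  { intros; now rewrite im_mult. }
  apply (@is_derive_plus R_AbsRing R_NormedModule); now apply M.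
Qed.

Lemma is_cderive_comp (f : R -> C) (g : R -> R) (x k : R) (l : C) :
  is_cderive f (g x) l -> is_derive g x k -> is_cderive (fun s => f (g s)) x (RtoC k * l).
Proof.
intros [F1 F2] G; split.
- rewrite re_scal_l. exact (is_derive_comp (fun y => Re (f y)) g x _ _ F1 G).
- rewrite im_scal_l. exact (is_derive_comp (fun y => Im (f y)) g x _ _ F2 G).
Qed.

Lemma Re2_Im2_neq_0 (z : C) : z <> 0 -> (Re z * Re z + Im z * Im z <> 0)%R.
Proof.
intros Hz H. apply Hz. destruct z as [x y]; simpl in H.
assert (x = 0 /\ y = 0)%R as [-> ->] by (split; nra). reflexivity.
Qed.

(** Covers both components of 1/z = (Re z - i Im z)/|z|^2: take f, g to be Re, Im for the real part
    and -Im, Re for the imaginary part. *)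
Lemma is_derive_inv_components (f g : R -> R) (x f' g' : R) :
  (f x ^ 2 + g x ^ 2 <> 0)%R -> is_derive f x f' -> is_derive g x g' ->
  is_derive (fun s => f s / (f s ^ 2 + g s ^ 2))%R x
    ((f' * (f x ^ 2 + g x ^ 2) - f x * (2 * f x * f' + 2 * g x * g')) /
     (f x ^ 2 + g x ^ 2) ^ 2)%R.
Proof.
intros H F G.
assert (D1 : ex_derive f x) by (eexists; exact F).
assert (D2 : ex_derive g x) by (eexists; exact G).
auto_derive.
- simpl in H. now repeat split.
- change (fun y : R => f y) with f. change (fun y : R => g y) with g.
  rewrite (is_derive_unique _ _ _ F), (is_derive_unique _ _ _ G). field.
  simpl in H. exact H.
Qed.

Lemma is_cderive_inv (f : R -> C) (x : R) (k : C) :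
  f x <> 0 -> is_cderive f x k -> is_cderive (fun s => / f s) x (- k * / (f x * f x)).
Proof.
intros Hf [F1 F2].
assert (H : (Re (f x) ^ 2 + Im (f x) ^ 2 <> 0)%R).
{ simpl; rewrite !Rmult_1_r. now apply Re2_Im2_neq_0. }
replace (/ (f x * f x)) with (/ f x * / f x) by (field; exact Hf).
split.
- eapply is_derive_eq; [|exact (is_derive_inv_components _ _ _ _ _ H F1 F2)].
  unfold Cinv. destruct (f x) as [y z], k as [k1 k2]. simpl in *. field.
  rewrite ?Rmult_1_r in H. exact H.
- apply is_derive_ext with (fun s => - Im (f s) / ((- Im (f s)) ^ 2 + Re (f s) ^ 2))%R.
  { intros s. unfold Cinv. destruct (f s); simpl. f_equal. ring. }
  eapply is_derive_eq; [|apply (is_derive_inv_components (fun s => - Im (f s))%R); [|apply (@is_derive_opp R_AbsRing R_NormedModule); exact F2|exact F1]].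
  + unfold Cinv. destruct (f x) as [y z], k as [k1 k2]. simpl in *. unfold opp; simpl. field.
    intros E; apply H; rewrite <- E; ring.
  + intros E; apply H; rewrite <- E; ring.
Qed.

(** * Integer powers and their derivatives *)

Lemma Cpowz_of_nat (z : C) (n : nat) : Cpowz z (Z.of_nat n) = Cpow z n.
Proof.
destruct n as [|n]; [reflexivity|]. unfold Cpowz. simpl Z.of_nat.
cbv iota beta. now rewrite SuccNat2Pos.id_succ.
Qed.

Lemma Cpowz_succ (z : C) (n : Z) : z <> 0 -> Cpowz z (n + 1) = Cpowz z n * z.
Proof.
intros Hz. destruct (Z_le_gt_dec 0 n) as [H|H].
- rewrite <- (Z2Nat.id n H). replace (Z.of_nat (Z.to_nat n) + 1)%Z with (Z.of_nat (S (Z.to_nat n))) by lia.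
  rewrite !Cpowz_of_nat, Cpow_S. ring.
- assert (E : forall m : nat, Cpowz z (- Z.of_nat m) = / Cpow z m).
  { intros [|m]; simpl.
    - field.
    - now rewrite SuccNat2Pos.id_succ. }
  set (m := Z.to_nat (- n - 1)).
  replace n with (- Z.of_nat (S m))%Z by (unfold m; lia).
  replace (- Z.of_nat (S m) + 1)%Z with (- Z.of_nat m)%Z by lia.
  rewrite !E, Cpow_S. field. split; [now apply Cpow_nz | trivial].
Qed.

Lemma Cpowz_nz (z : C) (n : Z) : z <> 0 -> Cpowz z n <> 0.
Proof.
intros Hz. assert (N : forall k, / Cpow z k <> 0).
{ intros k E. apply C1_nz. rewrite <- (Cinv_r (Cpow z k)) by now apply Cpow_nz.
  rewrite E; ring. }
destruct n; simpl; [apply C1_nz | now apply Cpow_nz | apply N].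
Qed.

Lemma Cpowz_add (z : C) (n m : Z) : z <> 0 -> Cpowz z (n + m) = Cpowz z n * Cpowz z m.
Proof.
intros Hz. revert m. apply Z.peano_ind.
- rewrite Z.add_0_r. simpl; ring.
- intros m IH. rewrite <- !Z.add_1_r, Z.add_assoc, !Cpowz_succ, IH by trivial. ring.
- intros m IH.
  (* The downward step is proved after multiplication by z, where [Cpowz_succ] applies; z is then
     cancelled. *)
  assert (E : Cpowz z (n + Z.pred m) * z = Cpowz z n * Cpowz z (Z.pred m) * z).
  { rewrite <- Cmult_assoc, <- !Cpowz_succ by trivial.
    replace (n + Z.pred m + 1)%Z with (n + m)%Z by lia.
    now replace (Z.pred m + 1)%Z with m by lia. }
  transitivity (Cpowz z (n + Z.pred m) * z * / z); [field; trivial|].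
  rewrite E. field; trivial.
Qed.

Lemma Cpowz_opp (z : C) (n : Z) : z <> 0 -> Cpowz z n * Cpowz z (- n) = 1.
Proof. intros Hz. rewrite <- Cpowz_add, Z.add_opp_diag_r by trivial. reflexivity. Qed.

Lemma is_cderive_powz (f : R -> C) (x : R) (k : C) (n : Z) :
  f x <> 0 -> is_cderive f x k ->
  is_cderive (fun s => Cpowz (f s) n) x (RtoC (IZR n) * Cpowz (f x) (n - 1) * k).
Proof.
intros Hf Hk.
assert (P : forall m : nat,
  is_cderive (fun s => Cpow (f s) m) x (RtoC (IZR (Z.of_nat m)) * Cpowz (f x) (Z.of_nat m - 1) * k)).
{ induction m as [|m IH].
  - eapply is_cderive_eq; [|exact (is_cderive_const 1 x)].
    symmetry. rewrite <- Cmult_assoc. apply Cmult_0_l.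
  - apply is_cderive_ext with (fun s => f s * Cpow (f s) m); [reflexivity|].
    eapply is_cderive_eq; [|exact (is_cderive_mult _ _ _ _ _ Hk IH)].
    cbv beta. rewrite <- Cpowz_of_nat.
    replace (Cpowz (f x) (Z.of_nat m)) with (Cpowz (f x) (Z.of_nat m - 1) * f x)
      by (rewrite <- Cpowz_succ by trivial; f_equal; lia).
    replace (Cpowz (f x) (Z.of_nat (S m) - 1)) with (Cpowz (f x) (Z.of_nat m - 1) * f x)
      by (rewrite <- Cpowz_succ by trivial; f_equal; lia).
    rewrite Nat2Z.inj_succ, succ_IZR, RtoC_plus. ring. }
destruct n as [|n|n].
- eapply is_cderive_eq; [|exact (is_cderive_const 1 x)].
  symmetry. rewrite <- Cmult_assoc. apply Cmult_0_l.
- rewrite <- (positive_nat_Z n). apply is_cderive_ext with (2 := P (Pos.to_nat n)).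
  intros s; now rewrite Cpowz_of_nat.
- specialize (P (Pos.to_nat n)).
  apply is_cderive_inv in P; [|now apply Cpow_nz].
  eapply is_cderive_eq; [|exact P]. cbv beta.
  rewrite <- Cpowz_of_nat, (positive_nat_Z n).
  change (Z.neg n) with (- Z.pos n)%Z. rewrite opp_IZR, RtoC_opp.
  pose proof (Cpowz_nz (f x) (Z.pos n) Hf).
  (* With every power written through q and f(x)^(-1), both sides become -n k / (q f(x)). *)
  set (q := Cpowz (f x) (Z.pos n)) in *.
  replace (Cpowz (f x) (Z.pos n - 1)) with (q * Cpowz (f x) (-1))
    by (unfold q; rewrite <- Cpowz_add by trivial; f_equal; lia).
  replace (Cpowz (f x) (- Z.pos n - 1)) with (/ q * Cpowz (f x) (-1)).
  { field. trivial. }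
  change (- Z.pos n - 1)%Z with (- Z.pos n + - 1)%Z.
  rewrite Cpowz_add by trivial. f_equal.
Qed.

Lemma Cpowz_mod (z : C) (n : Z) : z <> 0 -> Cmod (Cpowz z n) = powerRZ (Cmod z) n.
Proof.
intros Hz. destruct n; simpl; [apply Cmod_1 | apply Cmod_pow |].
rewrite Cmod_inv by now apply Cpow_nz. now rewrite Cmod_pow.
Qed.

(** * Mean value estimates and growth of solutions of u' = -u g *)

Lemma nondecreasing_of_derive (f f' : R -> R) (a b : R) :
  (a <= b)%R -> (forall s, (a <= s <= b)%R -> is_derive f s (f' s) /\ (0 <= f' s)%R) ->
  (f a <= f b)%R.
Proof.
intros Hab H.
destruct (MVT_gen f a b f') as [c [Hc E]].
- intros x Hx. rewrite Rmin_left, Rmax_right in Hx by trivial. apply H; lra.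
- intros x Hx. rewrite Rmin_left, Rmax_right in Hx by trivial.
  apply continuity_pt_filterlim. apply (@ex_derive_continuous R_AbsRing R_NormedModule).
  exists (f' x). apply H; lra.
- rewrite Rmin_left, Rmax_right in Hc by trivial.
  destruct (H c Hc) as [_ H0]. assert (0 <= f' c * (b - a))%R by (apply Rmult_le_pos; lra). lra.
Qed.

(** The factor 2 comes from applying the mean value theorem to the real and imaginary parts
    separately. *)
Lemma is_cderive_bounded_variation (f f' : R -> C) (a b B : R) :
  (a <= b)%R -> (forall s, (a <= s <= b)%R -> is_cderive f s (f' s) /\ (Cmod (f' s) <= B)%R) ->
  (Cmod (f b - f a) <= 2 * B * (b - a))%R.
Proof.
intros Hab H.
assert (M : forall g g' : R -> R,
  (forall s, (a <= s <= b)%R -> is_derive g s (g' s) /\ (Rabs (g' s) <= B)%R) ->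
  (Rabs (g b - g a) <= B * (b - a))%R).
{ intros g g' Hg. destruct (MVT_gen g a b g') as [c [Hc E]].
  - intros x Hx. rewrite Rmin_left, Rmax_right in Hx by trivial. apply Hg; lra.
  - intros x Hx. rewrite Rmin_left, Rmax_right in Hx by trivial.
    apply continuity_pt_filterlim. apply (@ex_derive_continuous R_AbsRing R_NormedModule).
    exists (g' x). apply Hg; lra.
  - rewrite Rmin_left, Rmax_right in Hc by trivial.
    rewrite E, Rabs_mult, (Rabs_pos_eq (b - a)) by lra.
    apply Rmult_le_compat_r; [lra | now apply Hg]. }
eapply Rle_trans; [apply Cmod_le_re_im|].
assert (M1 : (Rabs (Re (f b - f a)) <= B * (b - a))%R).
{ apply (M (fun s => Re (f s)) (fun s => Re (f' s))). intros s Hs.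
  destruct (H s Hs) as [[H1 _] H2]. split; [exact H1|].
  eapply Rle_trans; [apply re_le_Cmod | exact H2]. }
assert (M2 : (Rabs (Im (f b - f a)) <= B * (b - a))%R).
{ apply (M (fun s => Im (f s)) (fun s => Im (f' s))). intros s Hs.
  destruct (H s Hs) as [[_ H1] H2]. split; [exact H1|].
  eapply Rle_trans; [apply im_le_Cmod | exact H2]. }
lra.
Qed.

(** This is 2 Re(conj(u) u') with u' = -u g. The square is used because the modulus itself need not
    be differentiable where u vanishes. *)
Lemma is_derive_Cmod_sqr (u : R -> C) (g : C) (s : R) :
  is_cderive u s (- (u s * g)) ->
  is_derive (fun s => Cmod (u s) ^ 2)%R s (- (2 * Cmod (u s) ^ 2 * Re g))%R.
Proof.
intros [H1 H2].
apply is_derive_ext with (fun s => Re (u s) ^ 2 + Im (u s) ^ 2)%R.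
{ intros; now rewrite Cmod2_alt. }
eapply is_derive_eq; [|apply (@is_derive_plus R_AbsRing R_NormedModule);
  [exact (is_derive_pow _ 2 _ _ H1) | exact (is_derive_pow _ 2 _ _ H2)]].
change (@plus R_NormedModule) with Rplus.
rewrite Cmod2_alt. destruct (u s), g; simpl. ring.
Qed.

Section LinearEquation.

Variables (u g : R -> C) (a b : R).
Hypothesis Hab : (a <= b)%R.
Hypothesis Hu : forall s, (a <= s <= b)%R -> is_cderive u s (- (u s * g s)).

Lemma Cmod_nonincreasing :
  (forall s, (a <= s <= b)%R -> (0 <= Re (g s))%R) -> (Cmod (u b) <= Cmod (u a))%R.
Proof.
intros Hg.
assert (H : (- (Cmod (u a) ^ 2) <= - (Cmod (u b) ^ 2))%R).
{ apply (nondecreasing_of_derive (fun s => - (Cmod (u s) ^ 2))%R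
    (fun s => - - (2 * Cmod (u s) ^ 2 * Re (g s)))%R); [exact Hab|].
  intros s Hs; split.
  - apply (@is_derive_opp R_AbsRing R_NormedModule). now apply is_derive_Cmod_sqr, Hu.
  - rewrite Ropp_involutive. apply Rmult_le_pos; [|now apply Hg].
    apply Rmult_le_pos; [lra | apply pow2_ge_0]. }
pose proof (Cmod_ge_0 (u a)). pose proof (Cmod_ge_0 (u b)). nra.
Qed.

(** The function |u(s)|^2 exp(2P(s - a)) is nondecreasing: its derivative carries the factor P - Re
    g, which is nonnegative since Re g <= |g| <= P. *)
Lemma Cmod_lower_bound (P : R) :
  (forall s, (a <= s <= b)%R -> (Cmod (g s) <= P)%R) ->
  (exp (- (P * (b - a))) * Cmod (u a) <= Cmod (u b))%R.
Proof.
intros Hg.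
assert (H : (Cmod (u a) ^ 2 * exp (2 * P * (a - a)) <= Cmod (u b) ^ 2 * exp (2 * P * (b - a)))%R).
{ apply (nondecreasing_of_derive (fun s => Cmod (u s) ^ 2 * exp (2 * P * (s - a)))%R
    (fun s => - (2 * Cmod (u s) ^ 2 * Re (g s)) * exp (2 * P * (s - a)) +
       Cmod (u s) ^ 2 * (2 * P * exp (2 * P * (s - a))))%R); [exact Hab|].
  intros s Hs; split.
  - apply (is_derive_mult (fun s => Cmod (u s) ^ 2)%R (fun s => exp (2 * P * (s - a)))).
    + now apply is_derive_Cmod_sqr, Hu.
    + auto_derive; trivial. unfold Rminus. ring.
    + intros; apply Rmult_comm.
  - match goal with |- Rle _ ?X => replace X with (2 * (Cmod (u s) ^ 2 * exp (2 * P * (s - a))) * (P - Re (g s)))%R by ring end.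
    apply Rmult_le_pos.
    + apply Rmult_le_pos; [lra|]. apply Rmult_le_pos; [apply pow2_ge_0 | left; apply exp_pos].
    + specialize (Hg s Hs). pose proof (re_le_Cmod (g s)). pose proof (Rle_abs (Re (g s))). lra. }
rewrite Rminus_diag, Rmult_0_r, exp_0, Rmult_1_r in H.
(* Multiplying the inequality by e^2 clears the exponential; nonnegativity then allows the squares
   to be removed. *)
set (e := exp (- (P * (b - a)))).
assert (He : (e * e * exp (2 * P * (b - a)) = 1)%R).
{ unfold e. rewrite <- !exp_plus, <- exp_0. f_equal; ring. }
assert (He0 : (0 < e)%R) by apply exp_pos.
pose proof (Cmod_ge_0 (u a)). pose proof (Cmod_ge_0 (u b)).
assert ((e * Cmod (u a)) ^ 2 <= Cmod (u b) ^ 2)%R.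
{ replace (Cmod (u b) ^ 2)%R with (e * e * (Cmod (u b) ^ 2 * exp (2 * P * (b - a))))%R.
  - replace ((e * Cmod (u a)) ^ 2)%R with (e * e * Cmod (u a) ^ 2)%R by ring.
    apply Rmult_le_compat_l; [nra | exact H].
  - transitivity (Cmod (u b) ^ 2 * (e * e * exp (2 * P * (b - a))))%R; [ring|]. rewrite He; ring. }
assert (0 <= e * Cmod (u a))%R by (apply Rmult_le_pos; lra). nra.
Qed.

End LinearEquation.

(* Continuing [f] affinely to the left of [a] turns the one-sided derivative at [a]
   into a two-sided one. *)
Lemma is_cderive_extension (f F : R -> C) (a : R) :
  (forall t, (a <= t)%R ->
     @filterdiff R_AbsRing R_NormedModule C_R_NormedModule f
       (within (fun s => (a <= s)%R) (locally t))
       (fun y => @scal R_AbsRing C_R_NormedModule y (F t))) ->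
  exists u : R -> C, (forall s, (a <= s)%R -> u s = f s) /\
    (forall s, (a <= s)%R -> is_cderive u s (F s)).
Proof.
intros H.
exists (fun s => if Rle_dec a s then f s else f a + RtoC (s - a) * F a).
split.
{ intros s Hs. destruct (Rle_dec a s); [reflexivity | contradiction]. }
set (u := fun s => if Rle_dec a s then f s else f a + RtoC (s - a) * F a).
intros t Ht.
assert (K : forall eps : posreal, exists d : posreal, forall s, (Rabs (s - t) < d)%R ->
  (Cmod (u s - u t - RtoC (s - t) * F t) <= eps * Rabs (s - t))%R).
{ intros eps.
  destruct (H t Ht) as [_ D].
  assert (L : is_filter_lim (within (fun s : R => (a <= s)%R) (locally t)) t).
  { intros P HP. destruct HP as [d Hd]. exists d. intros y Hy _. now apply Hd. }
  specialize (D t L eps). destruct D as [d Hd].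
  assert (Ut : u t = f t) by (unfold u; destruct (Rle_dec a t); [reflexivity|contradiction]).
  assert (Q : forall s, (a <= s)%R -> (Rabs (s - t) < d)%R ->
    (Cmod (u s - u t - RtoC (s - t) * F t) <= eps * Rabs (s - t))%R).
  { intros s Has Hs. specialize (Hd s Hs Has).
    rewrite Ut. unfold u. destruct (Rle_dec a s); [|contradiction].
    eapply Rle_trans; [|exact Hd]. apply Req_le.
    rewrite Cmod_norm.
    change (scal (minus s t) (F t)) with (@scal R_AbsRing C_R_NormedModule (s - t)%R (F t)).
    f_equal. unfold Cminus. rewrite <- (scal_R_Cmult (s - t) (F t)). reflexivity. }
  destruct (Rle_lt_or_eq_dec _ _ Ht) as [Hlt|<-].
  (* For t > a, a radius at most t - a keeps s inside [a, +oo). *)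
  - assert (Hm : (0 < Rmin d (t - a))%R) by (apply Rmin_pos; [apply cond_pos | lra]).
    exists (mkposreal _ Hm). simpl. intros s Hs.
    pose proof (Rmin_l d (t - a)). pose proof (Rmin_r d (t - a)).
    apply Q; [|lra]. apply Rabs_def2 in Hs. lra.
  (* For t = a, the affine continuation has error exactly 0 to the left of a. *)
  - exists d. intros s Hs. destruct (Rle_dec a s) as [Has|Has]; [now apply Q|].
    rewrite Ut. unfold u. destruct (Rle_dec a s); [contradiction|].
    replace (f a + RtoC (s - a) * F a - f a - RtoC (s - a) * F a) with (RtoC 0) by ring.
    rewrite Cmod_0. apply Rmult_le_pos; [left; apply cond_pos | apply Rabs_pos]. }
assert (G : forall (v : R -> R) (m : R),
  (forall eps : posreal, exists d : posreal, forall s, (Rabs (s - t) < d)%R ->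
    (Rabs (v s - v t - (s - t) * m) <= eps * Rabs (s - t))%R) -> is_derive v t m).
{ intros v m Hv. split; [apply is_linear_scal_l|].
  intros x Hx. rewrite <- (is_filter_lim_locally_unique _ _ Hx).
  intros eps. destruct (Hv eps) as [d Hd]. exists d. intros s Hs. exact (Hd s Hs). }
split; apply G; intros eps; destruct (K eps) as [d Hd]; exists d; intros s Hs;
  specialize (Hd s Hs); (eapply Rle_trans; [|exact Hd]).
- eapply Rle_trans; [|apply re_le_Cmod]. apply Req_le. f_equal.
  unfold Cminus. rewrite !re_plus, !re_opp, re_scal_l. reflexivity.
- eapply Rle_trans; [|apply im_le_Cmod]. apply Req_le. f_equal.
  unfold Cminus. rewrite !im_plus, !im_opp, im_scal_l. reflexivity.
Qed.

(** * Exponential of the matrix <h> *)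

(** Coordinates for upper triangular matrices: the row and the distance to the right of the
    diagonal. Products become convolutions in the second coordinate, a natural number on which
    induction is possible. *)
Definition entry (A : zmatrix) (i : Z) (j : nat) : C := A i (i + Z.of_nat j)%Z.

Lemma entry_mul (A B : zmatrix) (i : Z) (j : nat) :
  entry (zm_mul A B) i j =
  csum (fun e => entry A i e * entry B (i + Z.of_nat e) (j - e)) j.
Proof.
unfold entry at 1, zm_mul. rewrite (proj2 (Z.leb_le _ _)) by lia.
replace (Z.to_nat (i + Z.of_nat j - i)) with j by lia.
apply sum_n_ext_loc. intros e He. unfold entry. f_equal. f_equal. lia.
Qed.

Lemma entry_one (i : Z) (j : nat) : entry zm_one i j = if Nat.eqb j 0 then 1 else 0.
Proof.
unfold entry, zm_one. destruct j as [|j]; simpl Nat.eqb; cbv iota.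
- now rewrite (proj2 (Z.eqb_eq _ _)) by lia.
- now rewrite (proj2 (Z.eqb_neq _ _)) by lia.
Qed.

Lemma entry_angle (h : nat -> C) (i : Z) (j : nat) :
  entry (angle h) i j = RtoC (IZR i) * h (S j).
Proof.
unfold entry, angle. cbv zeta.
destruct (Z.leb_spec (i + Z.of_nat j - i + 1) 0) as [H|H]; [lia|].
do 2 f_equal. lia.
Qed.

Lemma csum_single_last (f : nat -> C) (n : nat) :
  (forall k, (k < n)%nat -> f k = 0) -> (csum f n : C) = f n.
Proof.
intros H. destruct n as [|n]; [apply sum_O|].
rewrite csum_S. assert (E : (csum f n : C) = 0); [|rewrite E; ring].
transitivity (csum (fun _ => RtoC 0 * RtoC 0) n).
- apply sum_n_ext_loc. intros k Hk. rewrite H by lia. cring.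
- rewrite csum_mult_l. ring.
Qed.

Lemma csum_single_first (f : nat -> C) (n : nat) :
  (forall k, (0 < k)%nat -> f k = 0) -> (csum f n : C) = f O.
Proof.
intros H. induction n as [|n IH]; [apply sum_O|].
rewrite csum_S, IH, (H (S n)) by lia. ring.
Qed.

Lemma entry_mul_one_l (A : zmatrix) (i : Z) (j : nat) :
  entry (zm_mul zm_one A) i j = entry A i j.
Proof.
rewrite entry_mul, csum_single_first.
- rewrite entry_one. simpl. rewrite Z.add_0_r, Nat.sub_0_r. ring.
- intros k Hk. rewrite entry_one. destruct k; [lia|]. simpl. ring.
Qed.

Lemma entry_mul_one_r (A : zmatrix) (i : Z) (j : nat) :
  entry (zm_mul A zm_one) i j = entry A i j.
Proof.
rewrite entry_mul, csum_single_last.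
- rewrite entry_one, Nat.sub_diag. simpl. ring.
- intros k Hk. rewrite entry_one. replace (Nat.eqb (j - k) 0) with false; [ring|].
  symmetry. apply Nat.eqb_neq. lia.
Qed.

(** Both sides run over two successive jumps e, d with e + d <= j; [csum_triangle] passes from
    grouping by the first jump to grouping by the total. *)
Lemma entry_mul_assoc (A B D : zmatrix) (i : Z) (j : nat) :
  entry (zm_mul A (zm_mul B D)) i j = entry (zm_mul (zm_mul A B) D) i j.
Proof.
rewrite !entry_mul.
transitivity (csum (fun e => csum (fun d =>
  entry A i e * entry B (i + Z.of_nat e) d * entry D (i + Z.of_nat e + Z.of_nat d) (j - e - d)) (j - e)) j).
- apply sum_n_ext_loc. intros e He. rewrite entry_mul, <- csum_mult_l.
  apply sum_n_ext. intros d. cring.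
- rewrite <- (csum_triangle (fun e d => entry A i e * entry B (i + Z.of_nat e) d *
    entry D (i + Z.of_nat e + Z.of_nat d) (j - e - d)) j).
  apply sum_n_ext_loc. intros d Hd. rewrite entry_mul, <- csum_mult_r.
  apply sum_n_ext_loc. intros e He. f_equal. f_equal; lia.
Qed.

(** Replaces rewriting inside a product: the matrix identities used here hold only on and above the
    diagonal, where [entry] looks. *)
Lemma entry_mul_ext (A B A' B' : zmatrix) (i : Z) (j : nat) :
  (forall i j, entry A i j = entry A' i j) -> (forall i j, entry B i j = entry B' i j) ->
  entry (zm_mul A B) i j = entry (zm_mul A' B') i j.
Proof.
intros HA HB. rewrite !entry_mul. apply sum_n_ext. intros e. now rewrite HA, HB.
Qed.

(** [zm_pow] multiplies on the left, but the derivative of the exponential is needed as E<h>, with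
    <h> on the right where it meets v' = -<h>v. *)
Lemma entry_pow_S_r (A : zmatrix) (l : nat) (i : Z) (j : nat) :
  entry (zm_pow A (S l)) i j = entry (zm_mul (zm_pow A l) A) i j.
Proof.
revert i j. induction l as [|l IH]; intros i j.
- simpl zm_pow. now rewrite entry_mul_one_l, entry_mul_one_r.
- change (zm_pow A (S (S l))) with (zm_mul A (zm_pow A (S l))).
  rewrite (entry_mul_ext _ _ A (zm_mul (zm_pow A l) A)) by trivial.
  now rewrite entry_mul_assoc.
Qed.

Lemma entry_pow_scal (c : C) (A : zmatrix) (l : nat) (i : Z) (j : nat) :
  entry (zm_pow (zm_scal c A) l) i j = Cpow c l * entry (zm_pow A l) i j.
Proof.
revert i j. induction l as [|l IH]; intros i j.
- simpl. ring.
- simpl zm_pow. rewrite !entry_mul, <- csum_mult_l. apply sum_n_ext. intros e.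
  rewrite IH, Cpow_S. unfold entry at 1, zm_scal. fold (entry A i e). cring.
Qed.

Lemma is_series_exp (x : R) : is_series (fun l => x ^ l / INR (fact l))%R (exp x).
Proof.
pose proof (is_exp_Reals x) as H. unfold is_pseries in H.
revert H. apply is_series_ext. intros l. rewrite pow_n_pow. reflexivity.
Qed.

Lemma sum_n_le_is_series (f : nat -> R) (l : R) (n : nat) :
  (forall k, (0 <= f k)%R) -> is_series f l -> (sum_n f n <= l)%R.
Proof.
intros Hf H. apply (is_lim_seq_incr_compare (sum_n f) l); [exact H|].
intros m. rewrite sum_Sn. change (@plus R_AbelianMonoid) with Rplus. specialize (Hf (S m)). lra.
Qed.

Lemma cseries_csum (u : nat -> nat -> C) (l : nat -> C) (n : nat) :
  (forall e, (e <= n)%nat -> cseries (u e) (l e)) ->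
  cseries (fun k => csum (fun e => u e k) n) (csum l n).
Proof.
induction n as [|n IH]; intros H.
- rewrite sum_O. apply cseries_ext with (u O); [|apply H; lia].
  intros k. now rewrite sum_O.
- rewrite csum_S. apply cseries_ext with (fun k => csum (fun e => u e k) n + u (S n) k).
  + intros k. now rewrite csum_S.
  + apply cseries_plus; [apply IH; intros; apply H; lia | apply H; lia].
Qed.

(** * Convergence, size and derivative of the entries of exp(x<h>) *)

Section Exponential.

Variables (h : nat -> C) (c b : R).
Hypothesis Hc : (0 <= c)%R.
Hypothesis Hb : (0 < b)%R.
Hypothesis Hh : forall j, (Cmod (h (S j)) <= c * b ^ j)%R.

Let P (l : nat) (i : Z) (j : nat) : C := entry (zm_pow (angle h) l) i j.

(* The doubling of [c] and [b] pays for the number, at most 2^(l+j), of paths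
   i = i_0 <= ... <= i_l = i + j over which the entry of the power is summed. *)
Lemma entry_pow_angle_bound (K : R) (l : nat) (i : Z) (j : nat) :
  (Rabs (IZR i) <= K)%R -> (Rabs (IZR (i + Z.of_nat j)) <= K)%R ->
  (Cmod (P l i j) <= (2 * c * K) ^ l * (2 * b) ^ j)%R.
Proof.
intros Hi Hj. revert i j Hi Hj. unfold P.
induction l as [|l IH]; intros i j Hi Hj.
- simpl zm_pow. rewrite entry_one. destruct j as [|j]; simpl Nat.eqb; cbv iota.
  + rewrite Cmod_1. simpl. lra.
  + rewrite Cmod_0. simpl pow at 1. rewrite Rmult_1_l. apply pow_le. lra.
- simpl zm_pow. rewrite entry_mul.
  assert (HK : (0 <= K)%R) by (eapply Rle_trans; [apply Rabs_pos | exact Hi]).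
  assert (H2 : (0 <= (2 * c * K) ^ l)%R) by (apply pow_le; nra).
  (* A first jump e costs b^e = (2b)^e (1/2)^e, so summing over e gives a geometric factor at most
     2. *)
  apply Rle_trans with (sum_n (fun e => (c * K * (2 * c * K) ^ l * (2 * b) ^ j) * (/ 2) ^ e)%R j).
  + apply csum_mod_bound. intros e He. rewrite entry_angle, !Cmod_mult, Cmod_R.
    (* The row i + e lies between i and i + j, whose absolute values are at most K. *)
    assert (Hie : (Rabs (IZR (i + Z.of_nat e)) <= K)%R).
    { rewrite plus_IZR in *. rewrite <- INR_IZR_INZ in *.
      pose proof (le_INR _ _ He). pose proof (pos_INR e).
      apply Rabs_le_between in Hi, Hj. apply Rabs_le_between. lra. }
    assert (IHe : (Cmod (entry (zm_pow (angle h) l) (i + Z.of_nat e) (j - e)) <=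
                   (2 * c * K) ^ l * (2 * b) ^ (j - e))%R).
    { apply IH; [exact Hie|]. replace (i + Z.of_nat e + Z.of_nat (j - e))%Z with (i + Z.of_nat j)%Z by lia. exact Hj. }
    apply Rle_trans with ((K * (c * b ^ e)) * ((2 * c * K) ^ l * (2 * b) ^ (j - e)))%R.
    * apply Rmult_le_compat; trivial.
      -- apply Rmult_le_pos; [apply Rabs_pos | apply Cmod_ge_0].
      -- apply Cmod_ge_0.
      -- apply Rmult_le_compat; trivial; [apply Rabs_pos | apply Cmod_ge_0].
    * apply Req_le. replace ((2 * b) ^ j)%R with ((2 * b) ^ e * (2 * b) ^ (j - e))%R
        by (rewrite <- pow_add; f_equal; lia).
      replace (b ^ e)%R with ((2 * b) ^ e * (/ 2) ^ e)%R; [ring|].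
      rewrite <- Rpow_mult_distr. f_equal. field.
  + rewrite sum_n_Rmult_l.
    replace ((2 * c * K) ^ S l * (2 * b) ^ j)%R with (c * K * (2 * c * K) ^ l * (2 * b) ^ j * 2)%R
      by (simpl; ring).
    apply Rmult_le_compat_l; [|apply sum_n_geom_le; lra].
    repeat apply Rmult_le_pos; trivial. apply pow_le. lra.
Qed.

(** An admissible K for [entry_pow_angle_bound]: it dominates |k| for every row k from i to i +
    j. *)
Definition offset_norm (i : Z) (j : nat) : R := (Rabs (IZR i) + INR j)%R.

(** Up to a constant free of l, the bound is the l-th term of a real exponential series, so
    convergence is always by comparison with [exp]. *)
Lemma exp_term_bound (x : R) (d : nat) (l : nat) (i : Z) (j : nat) :
  (Cmod (Cpow (RtoC x) l * P (d + l) i j / RtoC (INR (fact l))) <=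
   (2 * c * offset_norm i j) ^ d * (2 * b) ^ j *
     ((2 * c * offset_norm i j * Rabs x) ^ l / INR (fact l)))%R.
Proof.
assert (Hf : (0 < INR (fact l))%R) by apply INR_fact_lt_0.
rewrite Cmod_div by (intros E; apply RtoC_inj in E; lra).
rewrite Cmod_mult, Cmod_pow, !Cmod_R, (Rabs_pos_eq (INR _)) by lra.
assert (HP : (Cmod (P (d + l) i j) <= (2 * c * offset_norm i j) ^ (d + l) * (2 * b) ^ j)%R).
{ unfold offset_norm. apply entry_pow_angle_bound.
  - pose proof (pos_INR j). lra.
  - rewrite plus_IZR, <- INR_IZR_INZ. eapply Rle_trans; [apply Rabs_triang|].
    rewrite (Rabs_pos_eq (INR j)) by apply pos_INR. lra. }
unfold Rdiv. rewrite <- Rmult_assoc. apply Rmult_le_compat_r; [left; now apply Rinv_0_lt_compat|].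
replace ((2 * c * offset_norm i j) ^ d * (2 * b) ^ j * (2 * c * offset_norm i j * Rabs x) ^ l)%R
  with (Rabs x ^ l * ((2 * c * offset_norm i j) ^ (d + l) * (2 * b) ^ j))%R
  by (rewrite (Rpow_mult_distr _ (Rabs x)), pow_add; ring).
apply Rmult_le_compat_l; [apply pow_le, Rabs_pos | exact HP].
Qed.

Definition exp_entry (x : R) (i : Z) (j : nat) : C :=
  entry (zm_exp (zm_scal (RtoC x) (angle h))) i j.

Lemma exp_entry_series (x : R) (i : Z) (j : nat) :
  cseries (fun l => Cpow (RtoC x) l * P l i j / RtoC (INR (fact l))) (exp_entry x i j).
Proof.
unfold exp_entry, entry, zm_exp.
apply cseries_ext with (fun k => zm_pow (zm_scal (RtoC x) (angle h)) k i (i + Z.of_nat j)%Z / RtoC (INR (fact k))).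
{ intros l. f_equal. apply entry_pow_scal. }
eapply CSeries_correct.
- intros l. refine (Rle_trans _ _ _ (Req_le _ _ _) (exp_term_bound x 0 l i j)).
  do 2 f_equal. apply entry_pow_scal.
- eexists. apply (@is_series_scal R_AbsRing R_NormedModule), is_series_exp.
Qed.

Lemma exp_entry_bound (x : R) (i : Z) (j : nat) :
  (Cmod (exp_entry x i j) <= exp (2 * c * offset_norm i j * Rabs x) * (2 * b) ^ j)%R.
Proof.
apply cseries_mod_le with (1 := exp_entry_series x i j). intros n.
eapply Rle_trans; [apply csum_mod_bound; intros k _; exact (exp_term_bound x 0 k i j)|].
rewrite sum_n_Rmult_l. rewrite pow_O, Rmult_1_l, Rmult_comm.
apply Rmult_le_compat_r; [apply pow_le; lra|].
apply sum_n_le_is_series; [|apply is_series_exp].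
intros k. apply Rmult_le_pos; [|left; apply Rinv_0_lt_compat, INR_fact_lt_0].
apply pow_le. unfold offset_norm. pose proof (pos_INR j). pose proof (Rabs_pos (IZR i)).
repeat apply Rmult_le_pos; try lra. apply Rabs_pos.
Qed.

(** The series is the termwise derivative of the one for [exp_entry]. Taking one factor <h> off on
    the right and exchanging the series with a finite sum gives the entry of exp(x<h>)<h>. *)
Lemma exp_entry_derive_series (x : R) (i : Z) (j : nat) :
  cseries (fun l => Cpow (RtoC x) l * P (S l) i j / RtoC (INR (fact l)))
    (csum (fun e => exp_entry x i e * entry (angle h) (i + Z.of_nat e) (j - e)) j).
Proof.
apply cseries_ext with (fun l => csum (fun e => entry (angle h) (i + Z.of_nat e) (j - e) *
  (Cpow (RtoC x) l * P l i e / RtoC (INR (fact l)))) j).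
- intros l. unfold P at 2. rewrite entry_pow_S_r, entry_mul.
  unfold Cdiv. rewrite <- csum_mult_l, <- csum_mult_r.
  apply sum_n_ext. intros e. unfold P. cring.
- rewrite (sum_n_ext _ (fun e => entry (angle h) (i + Z.of_nat e) (j - e) * exp_entry x i e))
    by (intros e; apply Cmult_comm).
  apply cseries_csum. intros e _. apply cseries_mult_l, exp_entry_series.
Qed.

(** Here f stands for [Re] or [Im]. Terms bounded at |x| + 1, strictly beyond |x|, put x inside the
    interval of convergence, where the series may be differentiated. *)
Lemma exp_coeff_radius (f : C -> R) (x : R) (i : Z) (j : nat) :
  (forall z, (Rabs (f z) <= Cmod z)%R) ->
  Rbar_lt (Rabs x) (CV_radius (fun l => f (P l i j) / INR (fact l))%R).
Proof.
intros Hf. set (r := (Rabs x + 1)%R).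
apply Rbar_lt_le_trans with (Finite r); [simpl; unfold r; lra|].
apply (proj1 (CV_radius_bounded _)).
exists (exp (2 * c * offset_norm i j * r) * (2 * b) ^ j)%R. intros l.
assert (Hr : (0 <= r)%R) by (unfold r; pose proof (Rabs_pos x); lra).
apply Rle_trans with ((2 * b) ^ j * ((2 * c * offset_norm i j * r) ^ l / INR (fact l)))%R.
- eapply Rle_trans; [|eapply Rle_trans; [exact (exp_term_bound r 0 l i j)|]].
  + assert (H0 : (0 < INR (fact l))%R) by apply INR_fact_lt_0.
    simpl (0 + l)%nat.
    rewrite Cmod_div by (intros E; apply RtoC_inj in E; lra).
    rewrite Cmod_mult, Cmod_pow, !Cmod_R, (Rabs_pos_eq (INR _)), (Rabs_pos_eq r) by lra.
    unfold Rdiv. rewrite !Rabs_mult, (Rabs_pos_eq (/ _)), (Rabs_pos_eq (r ^ l)).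
    * replace (r ^ l * Cmod (P l i j) * / INR (fact l))%R with (Cmod (P l i j) * (/ INR (fact l) * r ^ l))%R by ring.
      rewrite Rmult_assoc. apply Rmult_le_compat_r; [|apply Hf].
      apply Rmult_le_pos; [left; now apply Rinv_0_lt_compat | now apply pow_le].
    * now apply pow_le.
    * left; now apply Rinv_0_lt_compat.
  + rewrite (Rabs_pos_eq r) by trivial. rewrite pow_O, Rmult_1_l. apply Rle_refl.
- rewrite Rmult_comm. apply Rmult_le_compat_r; [apply pow_le; lra|].
  set (y := (2 * c * offset_norm i j * r)%R).
  assert (Hy : (0 <= y)%R).
  { unfold y, offset_norm. pose proof (pos_INR j). pose proof (Rabs_pos (IZR i)).
    repeat apply Rmult_le_pos; lra. }
  assert (N : forall k, (0 <= y ^ k / INR (fact k))%R).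
  { intros k. apply Rmult_le_pos; [now apply pow_le|left; apply Rinv_0_lt_compat, INR_fact_lt_0]. }
  (* A single term of the exponential series is at most its sum. *)
  eapply Rle_trans; [|apply (sum_n_le_is_series _ _ l N (is_series_exp y))].
  destruct l as [|l]; [rewrite sum_O; apply Rle_refl|].
  rewrite sum_Sn. change (@plus R_AbelianMonoid) with Rplus.
  assert (0 <= sum_n (fun k => y ^ k / INR (fact k)) l)%R.
  { rewrite sum_n_Reals. now apply cond_pos_sum. }
  lra.
Qed.

(** Stated for an abstract real-homogeneous f so that [Re] and [Im] are treated once; f applied to
    the entry is a real power series in s. *)
Lemma exp_component_derive (f : C -> R) (x : R) (i : Z) (j : nat) :
  (forall z, (Rabs (f z) <= Cmod z)%R) ->
  (forall (r : R) (z : C), f (RtoC r * z)%C = r * f z)%R ->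
  (forall u l, cseries u l -> is_series (fun n => f (u n)) (f l)) ->
  is_derive (fun s => f (exp_entry s i j)) x
   (f (csum (fun e => exp_entry x i e * entry (angle h) (i + Z.of_nat e) (j - e)) j)).
Proof.
intros Hf Hlin Hser.
assert (T : forall (s : R) l (z : C), (f (Cpow (RtoC s) l * z / RtoC (INR (fact l)))%C = f z / INR (fact l) * s ^ l)%R).
{ intros s l z. pose proof (INR_fact_neq_0 l).
  unfold Cdiv. rewrite <- RtoC_pow, <- RtoC_inv by trivial.
  replace (RtoC (s ^ l)%R * z * RtoC (/ INR (fact l))%R) with (RtoC (s ^ l * / INR (fact l))%R * z)
    by (rewrite RtoC_mult; ring).
  rewrite Hlin. field. trivial. }
set (q := fun l => (f (P l i j) / INR (fact l))%R).
apply is_derive_ext with (PSeries q).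
{ intros s. apply is_series_unique.
  eapply is_series_ext; [|exact (Hser _ _ (exp_entry_series s i j))].
  intros l. unfold q. cbv beta. now rewrite T. }
eapply is_derive_eq; [|apply is_derive_PSeries, exp_coeff_radius; exact Hf].
apply is_series_unique.
eapply is_series_ext; [|exact (Hser _ _ (exp_entry_derive_series x i j))].
intros l. cbv beta. rewrite T. unfold PS_derive, q. rewrite fact_simpl, mult_INR.
pose proof (INR_fact_neq_0 l). pose proof (not_0_INR (S l) ltac:(lia)).
match goal with |- @eq _ ?y ?z => change (@eq R y z) end. field. now split.
Qed.

Lemma exp_entry_derive (x : R) (i : Z) (j : nat) :
  is_cderive (fun s => exp_entry s i j) x
    (csum (fun e => exp_entry x i e * entry (angle h) (i + Z.of_nat e) (j - e)) j).
Proof.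
split.
- apply (exp_component_derive Re).
  + apply re_le_Cmod.
  + intros. rewrite re_scal_l. reflexivity.
  + intros u l H. now apply cseries_components in H.
- apply (exp_component_derive Im).
  + apply im_le_Cmod.
  + intros. rewrite im_scal_l. reflexivity.
  + intros u l H. now apply cseries_components in H.
Qed.

Lemma exp_entry_0 (i : Z) (j : nat) : exp_entry 0 i j = entry zm_one i j.
Proof.
apply cseries_unique with (1 := exp_entry_series 0 i j).
apply cseries_le with (fun _ => 0%R); [|apply is_lim_seq_const].
intros n. rewrite csum_single_first.
- unfold P. simpl. replace (_ - _) with (RtoC 0); [rewrite Cmod_0; lra|]. field.
- intros k Hk. destruct k; [lia|]. rewrite Cpow_S. unfold Cdiv. ring.
Qed.

End Exponential.

(** * Powers of a solution of the flow *)

(** One bound for exponents of either sign. For negative n it is the lower end l > 0 that keeps the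
    power finite. *)
Lemma powerRZ_bound (l : R) (n : Z) :
  (0 < l)%R -> exists D, (0 <= D)%R /\ forall y, (l <= y <= 1)%R -> (powerRZ y n <= D)%R.
Proof.
intros Hl. destruct n as [|k|k].
- exists 1%R. split; [lra|]. intros; simpl; lra.
- exists 1%R. split; [lra|]. intros y Hy. simpl. rewrite <- (pow1 (Pos.to_nat k)).
  apply pow_incr. lra.
- exists (/ l ^ Pos.to_nat k)%R. split.
  + left. now apply Rinv_0_lt_compat, pow_lt.
  + intros y Hy. simpl. apply Rinv_le_contravar; [now apply pow_lt | apply pow_incr; lra].
Qed.

Lemma exp_le_compat (y z : R) : (y <= z)%R -> (exp y <= exp z)%R.
Proof. intros [H| ->]; [left; now apply exp_increasing | apply Rle_refl]. Qed.

(** Absorbs row indices and numbers of summands into a geometric ratio. *)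
Lemma INR_S_le_pow2 (m : nat) : (INR (S m) <= 2 ^ m)%R.
Proof.
induction m as [|m IH]; [simpl; lra|].
rewrite S_INR. change (2 ^ S m)%R with (2 * 2 ^ m)%R.
assert (1 <= 2 ^ m)%R by (apply pow_R1_Rle; lra). lra.
Qed.

Lemma csum_shift (f : nat -> C) (n : nat) :
  f O = 0 -> (csum (fun j => f (S j)) n : C) = csum f (S n).
Proof.
intros H. induction n as [|n IH].
- rewrite csum_S, !sum_O, H. ring.
- rewrite csum_S, IH, (csum_S f (S n)). reflexivity.
Qed.

(** Splits |n| + e in the exponent: the row n goes into the constant and the offset e into the
    ratio, which is then the same for all rows. *)
Lemma exp_entry_geometric_bound (h : nat -> C) (c b : R) :
  (0 <= c)%R -> (0 < b)%R -> (forall j, (Cmod (h (S j)) <= c * b ^ j)%R) ->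
  forall (T x : R) (n : Z) (e : nat), (Rabs x <= T)%R ->
  (Cmod (exp_entry h x n e) <=
   exp (2 * c * Rabs (IZR n) * T) * (2 * b * exp (2 * c * T)) ^ e)%R.
Proof.
intros Hc Hb Hh T x n e Hx.
eapply Rle_trans; [apply (exp_entry_bound h c b Hc Hb Hh)|].
rewrite (Rpow_mult_distr (2 * b)).
replace (exp (2 * c * T) ^ e)%R with (exp (2 * c * INR e * T)).
- rewrite (Rmult_comm ((2 * b) ^ e)%R), <- Rmult_assoc.
  apply Rmult_le_compat_r; [apply pow_le; lra|].
  rewrite <- exp_plus. apply exp_le_compat.
  replace (2 * c * Rabs (IZR n) * T + 2 * c * INR e * T)%R with (2 * c * offset_norm n e * T)%R
    by (unfold offset_norm; ring).
  apply Rmult_le_compat_l; [|exact Hx].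
  unfold offset_norm. pose proof (pos_INR e). pose proof (Rabs_pos (IZR n)).
  repeat apply Rmult_le_pos; lra.
- rewrite <- (Rpower_pow e) by apply exp_pos. unfold Rpower. rewrite ln_exp. f_equal. ring.
Qed.

Section Flow.

Variables (h : nat -> C) (c b : R).
Hypothesis Hc : (0 <= c)%R.
Hypothesis Hb : (0 < b)%R.
Hypothesis Hh : forall j, (Cmod (h (S j)) <= c * b ^ j)%R.
Hypothesis Hh0 : h O = 0.

Variables (u q : R -> C) (a t l x : R).
Hypothesis Hat : (a <= t)%R.
Hypothesis Hl : (0 < l)%R.
Hypothesis Hu : forall s, (a <= s <= t)%R -> is_cderive u s (- q s).
Hypothesis Hq : forall s, (a <= s <= t)%R -> cseries (fun j => h j * Cpow (u s) j) (q s).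
Hypothesis Hbound : forall s, (a <= s <= t)%R -> (l <= Cmod (u s) <= x)%R.

Let r : R := (2 * b * exp (2 * c * (t - a)))%R.
Hypothesis Hx : (r * x <= / 8)%R.
Hypothesis Hx1 : (x <= 1)%R.

Variable n : Z.

Let truncated (m : nat) (s : R) : C :=
  csum (fun i => exp_entry h (s - t) n i * Cpowz (u s) (n + Z.of_nat i)) m.

(** What survives in the derivative of [truncated]: at jump e the truncated matrix sees only the
    Taylor polynomial of h of degree m - e + 1, while u' contains all of h(u). *)
Let defect (m : nat) (s : R) : C :=
  csum (fun e => exp_entry h (s - t) n e * (RtoC (IZR (n + Z.of_nat e)) *
    Cpowz (u s) (n + Z.of_nat e - 1)) *
    (csum (fun j => h j * Cpow (u s) j) (S (m - e)) - q s)) m.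

Lemma solution_neq_0 (s : R) : (a <= s <= t)%R -> u s <> 0.
Proof.
intros Hs E. specialize (Hbound s Hs). rewrite E, Cmod_0 in Hbound. lra.
Qed.

Lemma truncated_derive (m : nat) (s : R) :
  (a <= s <= t)%R -> is_cderive (truncated m) s (defect m s).
Proof.
intros Hs. pose proof (solution_neq_0 s Hs) as H0.
assert (HE : forall i, is_cderive (fun s => exp_entry h (s - t) n i) s
  (csum (fun e => exp_entry h (s - t) n e * entry (angle h) (n + Z.of_nat e) (i - e)) i)).
{ intros i. rewrite <- (Cmult_1_l (csum _ i)).
  apply (is_cderive_comp (fun y => exp_entry h y n i) (fun s => s - t)%R).
  - now apply (exp_entry_derive h c b).
  - auto_derive; trivial. }
eapply is_cderive_eq; [|
  apply (is_cderive_csum (fun i s => exp_entry h (s - t) n i * Cpowz (u s) (n + Z.of_nat i)));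
  intros k _; apply is_cderive_mult; [apply HE | apply is_cderive_powz; [exact H0 | now apply Hu]]].
cbv beta. rewrite csum_plus.
(* The contribution of E' = E<h> consists of jumps e, d with e + d <= m. Regrouped by e, and with n
   + e + d = (n + e - 1) + (d + 1), it shows the Taylor polynomial of h at u(s). *)
assert (E1 : csum (fun k => csum (fun e => exp_entry h (s - t) n e *
    entry (angle h) (n + Z.of_nat e) (k - e)) k * Cpowz (u s) (n + Z.of_nat k)) m =
  csum (fun e => exp_entry h (s - t) n e * (RtoC (IZR (n + Z.of_nat e)) *
    Cpowz (u s) (n + Z.of_nat e - 1)) * csum (fun j => h j * Cpow (u s) j) (S (m - e))) m).
{ transitivity (csum (fun e => csum (fun d => exp_entry h (s - t) n e *
    entry (angle h) (n + Z.of_nat e) d * Cpowz (u s) (n + Z.of_nat e + Z.of_nat d)) (m - e)) m).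
  - rewrite <- csum_triangle. apply sum_n_ext. intros k. rewrite <- csum_mult_r.
    apply sum_n_ext_loc. intros e He. do 2 f_equal. lia.
  - apply sum_n_ext. intros e.
    rewrite <- (csum_shift (fun j => h j * Cpow (u s) j)) by (rewrite Hh0; ring).
    rewrite <- csum_mult_l. apply sum_n_ext. intros d. rewrite entry_angle.
    rewrite <- (Cpowz_of_nat (u s) (S d)).
    replace (n + Z.of_nat e + Z.of_nat d)%Z with ((n + Z.of_nat e - 1) + Z.of_nat (S d))%Z by lia.
    rewrite Cpowz_add by exact H0. cring. }
rewrite E1, <- csum_plus. apply sum_n_ext. intros e. cring.
Qed.

Lemma truncated_end (m : nat) : truncated m t = Cpowz (u t) n.
Proof.
unfold truncated. rewrite csum_single_first.
- rewrite Rminus_diag, (exp_entry_0 h c b Hc Hb Hh), entry_one, Z.add_0_r. simpl. ring.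
- intros k Hk. rewrite Rminus_diag, (exp_entry_0 h c b Hc Hb Hh), entry_one.
  destruct k; [lia|]. simpl Nat.eqb. cbv iota. ring.
Qed.

(** In the summand of index e the exponential contributes r^e, the power of u contributes x^e and
    the tail of h contributes (r x)^(m - e): together (r x)^m whatever e is. The row index costs 2^m
    and the m + 1 summands another 2^m; r x <= 1/8 leaves (1/2)^m. *)
Lemma defect_bound :
  exists K, (0 <= K)%R /\ forall m s, (a <= s <= t)%R -> (Cmod (defect m s) <= K * (/ 2) ^ m)%R.
Proof.
destruct (powerRZ_bound l (n - 1) Hl) as [D [HD0 HD]].
set (k := Rabs (IZR n)).
set (g := exp (2 * c * k * (t - a))).
exists (g * (k + 1) * D * (2 * (c / b)))%R.
assert (Hk : (0 <= k)%R) by apply Rabs_pos.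
assert (Hg : (0 < g)%R) by apply exp_pos.
assert (Hcb : (0 <= c / b)%R) by (apply Rmult_le_pos; [trivial | left; now apply Rinv_0_lt_compat]).
assert (Hr : (2 * b <= r)%R).
{ unfold r. rewrite <- (Rmult_1_r (2 * b)) at 1. apply Rmult_le_compat_l; [lra|].
  rewrite <- exp_0. apply exp_le_compat. repeat apply Rmult_le_pos; lra. }
assert (Hx0 : (0 < x)%R).
{ specialize (Hbound a ltac:(lra)). lra. }
assert (HK : (0 <= g * (k + 1) * D * (2 * (c / b)))%R) by (apply Rmult_le_pos; [repeat apply Rmult_le_pos; lra | lra]).
split; [exact HK|].
intros m s Hs. destruct (Hbound s Hs) as [B1 B2]. pose proof (solution_neq_0 s Hs) as H0.
assert (Hrx : (0 <= r * x)%R) by (apply Rmult_le_pos; lra).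
assert (Hbx : (b * x <= r * x)%R) by (apply Rmult_le_compat_r; lra).
assert (Hbx0 : (0 <= b * x)%R) by (apply Rmult_le_pos; lra).
apply Rle_trans with (sum_n (fun _ => (g * (k + 1) * D * (2 * (c / b)) * (/ 4) ^ m)%R) m).
2:{ rewrite sum_n_const. rewrite Rmult_comm, Rmult_assoc. apply Rmult_le_compat_l; [exact HK|].
  apply Rle_trans with ((/ 4) ^ m * 2 ^ m)%R.
  - apply Rmult_le_compat_l; [apply pow_le; lra | apply INR_S_le_pow2].
  - rewrite <- Rpow_mult_distr. apply Req_le. f_equal. lra. }
apply csum_mod_bound. intros e He.
rewrite !Cmod_mult, Cmod_R.
assert (T1 : (Cmod (exp_entry h (s - t) n e) <= g * r ^ e)%R).
{ apply (exp_entry_geometric_bound h c b Hc Hb Hh). rewrite Rabs_left1; lra. }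
assert (T2 : (Rabs (IZR (n + Z.of_nat e)) <= (k + 1) * 2 ^ m)%R).
{ rewrite plus_IZR, <- INR_IZR_INZ. eapply Rle_trans; [apply Rabs_triang|].
  rewrite (Rabs_pos_eq (INR e)) by apply pos_INR. fold k.
  pose proof (INR_S_le_pow2 m) as H2. rewrite S_INR in H2. pose proof (le_INR _ _ He).
  assert (1 <= 2 ^ m)%R by (apply pow_R1_Rle; lra). nra. }
assert (T3 : (Cmod (Cpowz (u s) (n + Z.of_nat e - 1)) <= D * x ^ e)%R).
{ replace (n + Z.of_nat e - 1)%Z with ((n - 1) + Z.of_nat e)%Z by lia.
  rewrite Cpowz_add, Cmod_mult, Cpowz_of_nat, Cmod_pow, Cpowz_mod by exact H0.
  apply Rmult_le_compat.
  - rewrite <- Cpowz_mod by exact H0. apply Cmod_ge_0.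
  - apply pow_le, Cmod_ge_0.
  - apply HD. lra.
  - apply pow_incr. split; [apply Cmod_ge_0 | exact B2]. }
assert (T4 : (Cmod (csum (fun j => h j * Cpow (u s) j)%C (S (m - e)) - q s)%C <=
              2 * (c / b) * (r * x) ^ (m - e))%R).
{ rewrite <- Cmod_opp, Copp_minus_distr.
  eapply Rle_trans; [apply (cseries_tail _ _ (c / b) (b * x) _ (Hq s Hs)); trivial; [lra|]|].
  - intros j Hj. destruct j as [|j]; [lia|].
    rewrite Cmod_mult, Cmod_pow.
    replace (c / b * (b * x) ^ S j)%R with (c * b ^ j * x ^ S j)%R
      by (rewrite Rpow_mult_distr; simpl; field; lra).
    apply Rmult_le_compat; [apply Cmod_ge_0 | apply pow_le, Cmod_ge_0 | apply Hh|].
    apply pow_incr. split; [apply Cmod_ge_0 | exact B2].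
  - apply Rmult_le_compat_l; [lra|].
    (* The tail starts at degree m - e + 2; the two surplus factors b x <= 1 are dropped. *)
    change ((b * x) ^ S (S (m - e)))%R with (b * x * (b * x * (b * x) ^ (m - e)))%R.
    assert (P0 : (0 <= (b * x) ^ (m - e))%R) by now apply pow_le.
    assert (P1 : ((b * x) ^ (m - e) <= (r * x) ^ (m - e))%R) by (apply pow_incr; lra).
    assert (P2 : (b * x * (b * x * (b * x) ^ (m - e)) <= 1 * (1 * (b * x) ^ (m - e)))%R).
    { apply Rmult_le_compat; try lra.
      - now apply Rmult_le_pos.
      - apply Rmult_le_compat_r; lra. }
    lra. }
apply Rle_trans with ((g * r ^ e) * (((k + 1) * 2 ^ m) * (D * x ^ e)) * (2 * (c / b) * (r * x) ^ (m - e)))%R.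
- apply Rmult_le_compat; trivial; try apply Cmod_ge_0.
  + apply Rmult_le_pos; [apply Cmod_ge_0|]. apply Rmult_le_pos; [apply Rabs_pos | apply Cmod_ge_0].
  + apply Rmult_le_compat; trivial; try apply Cmod_ge_0.
    * apply Rmult_le_pos; [apply Rabs_pos | apply Cmod_ge_0].
    * apply Rmult_le_compat; trivial; [apply Rabs_pos | apply Cmod_ge_0].
- replace ((g * r ^ e) * (((k + 1) * 2 ^ m) * (D * x ^ e)) * (2 * (c / b) * (r * x) ^ (m - e)))%R
    with (g * (k + 1) * D * (2 * (c / b)) * (2 * (r * x)) ^ m)%R.
  + apply Rmult_le_compat_l; [exact HK|]. apply pow_incr. lra.
  + rewrite (Rpow_mult_distr 2). replace ((r * x) ^ m)%R with ((r * x) ^ e * (r * x) ^ (m - e))%R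
      by (rewrite <- pow_add; f_equal; lia).
    rewrite (Rpow_mult_distr r x e). ring.
Qed.

Lemma flow_powers :
  cseries (fun i => exp_entry h (a - t) n i * Cpowz (u a) (n + Z.of_nat i)) (Cpowz (u t) n).
Proof.
destruct defect_bound as [K [HK0 HK]].
apply cseries_le with (fun m => 2 * K * (t - a) * (/ 2) ^ m)%R.
- intros m. rewrite <- Cmod_opp, Copp_minus_distr, <- (truncated_end m).
  eapply Rle_trans; [apply (is_cderive_bounded_variation (truncated m) (defect m) a t (K * (/ 2) ^ m)%R Hat)|].
  + intros s Hs. split; [now apply truncated_derive | now apply HK].
  + apply Req_le. ring.
- replace (Finite 0) with (Rbar_mult (2 * K * (t - a))%R 0) by (simpl; f_equal; ring).
  apply is_lim_seq_scal_l. apply is_lim_seq_geom. rewrite Rabs_pos_eq; lra.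
Qed.

End Flow.

(** * Coefficient bounds for power matrices *)

(** Summation by antidiagonals. Up to m it differs from the iterated sum by the tail of row i beyond
    m - i, for each i <= m. Each tail is at most 2K q^m, and q <= 1/4 absorbs the m + 1 of them. *)
Lemma cseries_double (alpha : nat -> C) (V : nat -> nat -> C) (s : nat -> C) (L : C) (K q : R) :
  (0 <= K)%R -> (0 <= q <= / 4)%R ->
  (forall i d, (Cmod (alpha i * V i d) <= K * q ^ i * q ^ d)%R) ->
  (forall i, cseries (V i) (s i)) -> cseries (fun i => alpha i * s i) L ->
  cseries (fun j => csum (fun i => alpha i * V i (j - i)%nat) j) L.
Proof.
intros HK Hq HV Hs HL.
apply cseries_le with
  (fun m => 2 * K * (/ 2) ^ m + Cmod (csum (fun i => alpha i * s i)%C m - L)%C)%R.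
- intros m. rewrite (csum_triangle (fun i d => alpha i * V i d)).
  set (T := csum (fun i => alpha i * s i) m).
  match goal with |- Rle (Cmod (?X - L)) _ =>
    replace (X - L) with (- (T - X) + (T - L)) by ring end.
  eapply Rle_trans; [apply Cmod_triangle|]. apply Rplus_le_compat_r. rewrite Cmod_opp.
  unfold T.
  match goal with |- Rle (Cmod (?X - ?Y)) _ =>
    replace (X - Y) with (csum (fun i => alpha i * s i + (- (1)) * csum (fun d => alpha i * V i d) (m - i)) m)
      by (rewrite csum_plus, csum_mult_l; cring) end.
  apply Rle_trans with (sum_n (fun _ => 2 * K * q ^ m)%R m).
  + apply csum_mod_bound. intros i Hi.
    replace (alpha i * s i + - (1) * csum (fun d => alpha i * V i d) (m - i))
      with (alpha i * s i - csum (fun d => alpha i * V i d) (m - i)) by ring.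
    assert (Hqi : (0 <= q ^ i)%R) by (apply pow_le; lra).
    eapply Rle_trans; [apply (cseries_tail (fun d => alpha i * V i d) (alpha i * s i) (K * q ^ i) q)|].
    * now apply cseries_mult_l.
    * now apply Rmult_le_pos.
    * lra.
    * intros k _. apply HV.
    * replace (q ^ m)%R with (q ^ i * q ^ (m - i))%R by (rewrite <- pow_add; f_equal; lia).
      assert (0 <= q ^ (m - i))%R by (apply pow_le; lra).
      rewrite <- !Rmult_assoc, (Rmult_assoc _ _ (q ^ S (m - i))), (Rmult_assoc _ _ (q ^ (m - i))).
      apply Rmult_le_compat_l; [lra|].
      apply Rmult_le_compat_l; [exact Hqi|]. simpl. nra.
  + rewrite sum_n_const, Rmult_comm, Rmult_assoc. apply Rmult_le_compat_l; [lra|].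
    apply Rle_trans with ((/ 4) ^ m * 2 ^ m)%R.
    * apply Rmult_le_compat; [apply pow_le; lra | apply pos_INR | apply pow_incr; lra | apply INR_S_le_pow2].
    * rewrite <- Rpow_mult_distr. apply Req_le. f_equal. lra.
- replace (Finite 0) with (Finite (2 * K * 0 + 0)) by (f_equal; ring).
  apply is_lim_seq_plus'; [|now apply cseries_lim].
  apply (is_lim_seq_scal_l (fun m => (/ 2) ^ m)%R (2 * K)%R 0).
  apply is_lim_seq_geom. rewrite Rabs_pos_eq; lra.
Qed.

Lemma cseries_term_bound (u : nat -> C) (l : C) :
  cseries u l -> exists M, (0 <= M)%R /\ forall n, (Cmod (u n) <= M)%R.
Proof.
intros H.
destruct (@filterlim_bounded C_AbsRing C_NormedModule (csum u) (ex_intro _ l H)) as [M HM].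
assert (HM' : forall n, (Cmod (csum u n) <= M)%R) by exact HM.
assert (H0 : (0 <= M)%R) by (eapply Rle_trans; [apply Cmod_ge_0 | apply (HM' O)]).
exists (2 * M)%R. split; [lra|]. intros [|n].
- specialize (HM' O). rewrite sum_O in HM'. lra.
- replace (u (S n)) with (csum u (S n) + - csum u n) by (rewrite csum_S; ring).
  eapply Rle_trans; [apply Cmod_triangle|]. rewrite Cmod_opp.
  pose proof (HM' n). pose proof (HM' (S n)). lra.
Qed.

Lemma cseries_coeff_bound (alpha : nat -> C) (z l : C) :
  z <> 0 -> cseries (fun j => alpha j * Cpow z j) l ->
  exists M, (0 <= M)%R /\ forall j, (Cmod (alpha j) <= M * (/ Cmod z) ^ j)%R.
Proof.
intros Hz H. destruct (cseries_term_bound _ _ H) as [M [HM0 HM]].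
exists M. split; [exact HM0|]. intros j. specialize (HM j).
rewrite Cmod_mult, Cmod_pow in HM. apply Cmod_gt_0 in Hz.
rewrite pow_inv. apply Rmult_le_reg_r with (Cmod z ^ j)%R; [now apply pow_lt|].
rewrite Rmult_assoc, Rinv_l, Rmult_1_r; [exact HM|]. apply pow_nonzero. lra.
Qed.

(** If the coefficients before m vanish, then |d m| y^m is bounded by the tail, of order y^(m + 1);
    letting y tend to 0 gives d m = 0. The disc is punctured because a power matrix is tested off 0
    only. *)
Lemma power_series_zero (d : nat -> C) (r : R) :
  (0 < r)%R ->
  (forall z, (0 < Cmod z < r)%R -> cseries (fun j => d j * Cpow z j) (RtoC 0)) ->
  forall j, d j = 0.
Proof.
intros Hr H.
destruct (cseries_coeff_bound d (RtoC (r / 2)) (RtoC 0)) as [M [HM0 HM]].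
{ intros E. apply RtoC_inj in E. lra. }
{ apply H. rewrite Cmod_R, Rabs_pos_eq; lra. }
rewrite Cmod_R, Rabs_pos_eq in HM by lra.
set (B := (/ (r / 2))%R) in *.
assert (HB : (0 < B)%R) by (apply Rinv_0_lt_compat; lra).
assert (HBr : (B * r = 2)%R) by (unfold B; field; lra).
intros j. induction j as [m IH] using (well_founded_induction lt_wf).
(* Since B r = 2, the condition y <= r/4 makes the ratio B y at most 1/2, as [cseries_tail]
   requires. *)
assert (K : forall y, (0 < y <= r / 4)%R -> (Cmod (d m) <= 2 * M * B ^ S m * y)%R).
{ intros y Hy.
  assert (Hym : (Cmod y = y)%R) by (rewrite Cmod_R, Rabs_pos_eq; lra).
  assert (HS : cseries (fun j => d j * Cpow (RtoC y) j) (RtoC 0)) by (apply H; rewrite Hym; lra).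
  assert (T : (Cmod (0 - csum (fun j => d j * Cpow (RtoC y) j) m)%C <= 2 * M * (B * y) ^ S m)%R).
  { apply cseries_tail; trivial.
    - split; [apply Rmult_le_pos; lra|]. apply Rle_trans with (B * (r / 4))%R; [apply Rmult_le_compat_l; lra|].
      apply Req_le. transitivity (B * r / 4)%R; [field|]. rewrite HBr. field.
    - intros k _. rewrite Cmod_mult, Cmod_pow, Hym, Rpow_mult_distr, <- Rmult_assoc.
      apply Rmult_le_compat_r; [apply pow_le; lra | apply HM]. }
  rewrite csum_single_last in T by (intros k Hk; rewrite (IH k Hk); ring).
  replace (0 - d m * Cpow (RtoC y) m) with (- (d m * Cpow (RtoC y) m)) in T by ring.
  rewrite Cmod_opp, Cmod_mult, Cmod_pow, Hym, Rpow_mult_distr in T.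
  apply Rmult_le_reg_r with (y ^ m)%R; [apply pow_lt; lra|].
  eapply Rle_trans; [exact T|]. apply Req_le. simpl. ring. }
apply Cmod_eq_0. apply Rle_antisym; [|apply Cmod_ge_0].
apply Rnot_lt_le. intros Hd.
set (A := (2 * M * B ^ S m)%R) in *.
assert (HA : (0 <= A)%R) by (unfold A; apply Rmult_le_pos; [lra | apply pow_le; lra]).
(* This y yields |d m| <= A y <= |d m|/2, a contradiction; A + 1 keeps the denominator positive. *)
set (y := Rmin (r / 4) (Cmod (d m) / (2 * (A + 1)))%R).
assert (Hy0 : (0 < y)%R).
{ unfold y. apply Rmin_pos; [lra|]. apply Rdiv_lt_0_compat; lra. }
assert (Hy1 : (y <= r / 4)%R) by apply Rmin_l.
assert (Hy2 : (y <= Cmod (d m) / (2 * (A + 1)))%R) by apply Rmin_r.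
specialize (K y (conj Hy0 Hy1)).
assert (A * y <= (A + 1) * (Cmod (d m) / (2 * (A + 1))))%R by (apply Rmult_le_compat; lra).
replace ((A + 1) * (Cmod (d m) / (2 * (A + 1))))%R with (Cmod (d m) / 2)%R in * by (field; lra).
lra.
Qed.

(** Dividing by z^n turns the Laurent expansion of row n into an ordinary power series. *)
Lemma power_series_row (A : zmatrix) (n : Z) (z L : C) :
  z <> 0 ->
  cseries (fun j => A n (n + Z.of_nat j)%Z * Cpowz z (n + Z.of_nat j)) L ->
  cseries (fun j => entry A n j * Cpow z j) (L * Cpowz z (- n)).
Proof.
intros Hz H. rewrite Cmult_comm. apply cseries_mult_l with (c := Cpowz z (- n)) in H.
revert H. apply cseries_ext. intros j. unfold entry.
rewrite Cpowz_add, Cpowz_of_nat by exact Hz.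
transitivity (A n (n + Z.of_nat j)%Z * Cpow z j * (Cpowz z n * Cpowz z (- n))); [ring|].
rewrite Cpowz_opp by exact Hz. ring.
Qed.

Section PowerMatrixBound.

Variables (f : C -> C) (A : zmatrix) (r : R).
Hypothesis Hr : (0 < r)%R.
Hypothesis HA : forall (n : Z) (z : C), (0 < Cmod z < r)%R ->
  cseries (fun j => A n (n + Z.of_nat j)%Z * Cpowz z (n + Z.of_nat j)) (Cpowz (f z) n).

(** The reciprocal of r/2, the point at which the rows are evaluated to bound their coefficients. *)
Let B : R := (2 / r)%R.

Lemma power_matrix_row (n : Z) (z : C) : (0 < Cmod z < r)%R ->
  cseries (fun j => entry A n j * Cpow z j) (Cpowz (f z) n * Cpowz z (- n)).
Proof.
intros Hz. apply power_series_row; [apply Cmod_gt_0; lra | now apply HA].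
Qed.

Lemma power_matrix_row_bound (n : Z) :
  exists M, (0 <= M)%R /\ forall j, (Cmod (entry A n j) <= M * B ^ j)%R.
Proof.
assert (E : (Cmod (RtoC (r / 2)) = r / 2)%R) by (rewrite Cmod_R, Rabs_pos_eq; lra).
destruct (cseries_coeff_bound (entry A n) (RtoC (r / 2)) _
  ltac:(apply Cmod_gt_0; rewrite E; lra)
  (power_matrix_row n (RtoC (r / 2)) ltac:(rewrite E; lra))) as [M [H0 HM]].
exists M. split; [exact H0|]. intros j. rewrite E in HM.
replace B with (/ (r / 2))%R by (unfold B; field; lra). apply HM.
Qed.

(** Compares coefficients in f^(k + 1) = f f^k, by uniqueness of power series. *)
Lemma power_matrix_row_S (k : nat) (j : nat) :
  entry A (Z.of_nat (S k)) j =
  csum (fun i => entry A 1 i * entry A (Z.of_nat k) (j - i)) j.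
Proof.
destruct (power_matrix_row_bound 1) as [M1 [HM1 H1]].
destruct (power_matrix_row_bound (Z.of_nat k)) as [Mk [HMk Hk]].
apply Ceq_minus. revert j.
(* For |z| < r/8 the ratio B |z| is at most 1/4, as [cseries_double] requires. *)
apply power_series_zero with (r := (r / 8)%R); [lra|].
intros z Hz.
assert (Hz0 : z <> 0) by (apply Cmod_gt_0; lra).
pose proof (power_matrix_row 1 z ltac:(lra)) as S1.
pose proof (power_matrix_row (Z.of_nat k) z ltac:(lra)) as Sk.
pose proof (power_matrix_row (Z.of_nat (S k)) z ltac:(lra)) as SS.
set (L1 := Cpowz (f z) 1 * Cpowz z (- (1))) in *.
set (Lk := Cpowz (f z) (Z.of_nat k) * Cpowz z (- Z.of_nat k)) in *.
assert (EL : Cpowz (f z) (Z.of_nat (S k)) * Cpowz z (- Z.of_nat (S k)) = L1 * Lk).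
{ unfold L1, Lk. rewrite !Cpowz_of_nat, Cpow_S.
  replace (- Z.of_nat (S k))%Z with (- (1) + - Z.of_nat k)%Z by lia.
  rewrite Cpowz_add by exact Hz0. change (Cpowz (f z) 1) with (Cpow (f z) 1).
  rewrite Cpow_1_r. ring. }
rewrite EL in SS.
assert (SP : cseries (fun j => csum (fun i => (entry A 1 i * Cpow z i) *
   (entry A (Z.of_nat k) (j - i) * Cpow z (j - i))) j) (L1 * Lk)).
{ apply (cseries_double (fun i => entry A 1 i * Cpow z i)
    (fun _ d => entry A (Z.of_nat k) d * Cpow z d) (fun _ => Lk) _ (M1 * Mk) (B * Cmod z)).
  - now apply Rmult_le_pos.
  - unfold B. split.
    + apply Rmult_le_pos; [apply Rlt_le, Rdiv_lt_0_compat; lra | lra].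
    + apply Rle_trans with (2 / r * (r / 8))%R.
      * apply Rmult_le_compat_l; [apply Rlt_le, Rdiv_lt_0_compat; lra | lra].
      * apply Req_le. field. lra.
  - intros i d. rewrite !Cmod_mult, !Cmod_pow, !Rpow_mult_distr.
    replace (M1 * Mk * (B ^ i * Cmod z ^ i) * (B ^ d * Cmod z ^ d))%R
      with ((M1 * B ^ i * Cmod z ^ i) * (Mk * B ^ d * Cmod z ^ d))%R by ring.
    assert (P : forall e, (0 <= Cmod z ^ e)%R) by (intros; apply pow_le, Cmod_ge_0).
    apply Rmult_le_compat; try (apply Rmult_le_pos; [apply Cmod_ge_0 | apply P]);
      apply Rmult_le_compat_r; trivial.
  - intros _. exact Sk.
  - apply cseries_ext with (fun i => Lk * (entry A 1 i * Cpow z i)); [intros; cring|].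
    rewrite Cmult_comm. now apply cseries_mult_l. }
apply cseries_mult_l with (c := - (1)) in SP.
pose proof (cseries_plus _ _ _ _ SS SP) as D.
replace (L1 * Lk + - (1) * (L1 * Lk)) with (RtoC 0) in D by ring.
revert D. apply cseries_ext. intros j. unfold Cminus.
rewrite Cmult_plus_distr_r. f_equal.
transitivity (- (csum (fun i => entry A 1 i * entry A (Z.of_nat k) (j - i)) j * Cpow z j)); [|cring].
transitivity (- csum (fun i => entry A 1 i * Cpow z i *
   (entry A (Z.of_nat k) (j - i) * Cpow z (j - i))) j); [cring|].
f_equal. rewrite <- csum_mult_r. apply sum_n_ext_loc. intros i Hi.
replace (Cpow z j) with (Cpow z i * Cpow z (j - i)) by (rewrite <- Cpow_add_r; f_equal; lia).
cring.
Qed.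

(** S and T serve all n, and only D depends on n. Rows from 1 on are convolution powers of row 1,
    each factor costing at most 2(M + 1); when n <= 0, only finitely many further rows occur and D
    absorbs them. *)
Lemma power_matrix_bound :
  exists S T : R, (0 < S)%R /\ (0 < T)%R /\ forall n : Z, exists D, (0 <= D)%R /\
    forall i d, (Cmod (entry A (n + Z.of_nat i) d) <= D * S ^ i * T ^ d)%R.
Proof.
assert (HB : (0 < B)%R) by (apply Rdiv_lt_0_compat; lra).
destruct (power_matrix_row_bound 1) as [M [HM0 HM]].
exists (2 * (M + 1))%R, (2 * B)%R. split; [lra|]. split; [lra|].
(* Rows are counted from n + 1, so that induction over the integers starts at row 1. *)
assert (HP : forall n, exists D, (0 <= D)%R /\
  forall i d, (Cmod (entry A (n + 1 + Z.of_nat i) d) <= D * (2 * (M + 1)) ^ i * (2 * B) ^ d)%R).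
{ apply Z.peano_ind.
  - exists (M + 1)%R. split; [lra|]. intros i.
    replace (0 + 1 + Z.of_nat i)%Z with (Z.of_nat (S i)) by lia.
    induction i as [|i IH]; intros d.
    + change (Z.of_nat 1) with 1%Z. eapply Rle_trans; [apply HM|].
      rewrite (Rpow_mult_distr 2 B), pow_O, Rmult_1_r.
      assert (P : (0 <= B ^ d)%R) by (apply pow_le; lra).
      assert (Q : (1 <= 2 ^ d)%R) by (apply pow_R1_Rle; lra).
      apply Rle_trans with ((M + 1) * (1 * B ^ d))%R.
      * rewrite Rmult_1_l. apply Rmult_le_compat_r; lra.
      * apply Rmult_le_compat_l; [lra|]. apply Rmult_le_compat_r; lra.
    + rewrite power_matrix_row_S.
      apply Rle_trans with (sum_n (fun e => ((M + 1) * ((M + 1) * (2 * (M + 1)) ^ i) * (2 * B) ^ d) * (/ 2) ^ e)%R d).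
      * apply csum_mod_bound. intros e He. rewrite Cmod_mult.
        apply Rle_trans with (((M + 1) * B ^ e) * ((M + 1) * (2 * (M + 1)) ^ i * (2 * B) ^ (d - e)))%R.
        -- apply Rmult_le_compat; try apply Cmod_ge_0; [|apply IH].
           eapply Rle_trans; [apply HM|]. apply Rmult_le_compat_r; [apply pow_le; lra | lra].
        -- apply Req_le. replace ((2 * B) ^ d)%R with ((2 * B) ^ e * (2 * B) ^ (d - e))%R
             by (rewrite <- pow_add; f_equal; lia).
           replace (B ^ e)%R with ((2 * B) ^ e * (/ 2) ^ e)%R; [ring|].
           rewrite <- Rpow_mult_distr. f_equal. field.
      * rewrite sum_n_Rmult_l.
        replace ((M + 1) * (2 * (M + 1)) ^ S i * (2 * B) ^ d)%R with
          ((M + 1) * ((M + 1) * (2 * (M + 1)) ^ i) * (2 * B) ^ d * 2)%R by (simpl; ring).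
        apply Rmult_le_compat_l; [|apply sum_n_geom_le; lra].
        assert (0 <= (2 * (M + 1)) ^ i)%R by (apply pow_le; lra).
        assert (0 <= (2 * B) ^ d)%R by (apply pow_le; lra).
        repeat apply Rmult_le_pos; lra.
  - intros n [D [HD0 HD]]. exists (D * (2 * (M + 1)))%R. split; [apply Rmult_le_pos; lra|].
    intros i d. specialize (HD (S i) d).
    replace (Z.succ n + 1 + Z.of_nat i)%Z with (n + 1 + Z.of_nat (S i))%Z by lia.
    eapply Rle_trans; [exact HD|]. apply Req_le. simpl. ring.
  - intros n [D [HD0 HD]]. destruct (power_matrix_row_bound (Z.pred n + 1)) as [M' [HM0' HM']].
    (* M' covers the added row i = 0. For the other rows i has grown by one, which the division by S
       = 2(M + 1) compensates. *)
    exists (M' + D / (2 * (M + 1)))%R.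
    assert (HD1 : (0 <= D / (2 * (M + 1)))%R).
    { apply Rmult_le_pos; [exact HD0 | left; apply Rinv_0_lt_compat; lra]. }
    split; [lra|]. intros i d.
    assert (P2 : (0 <= (2 * B) ^ d)%R) by (apply pow_le; lra).
    destruct i as [|i].
    + rewrite Z.add_0_r. eapply Rle_trans; [apply HM'|].
      simpl ((2 * (M + 1)) ^ 0)%R. rewrite Rmult_1_r.
      apply Rmult_le_compat; trivial; [apply pow_le; lra | lra | apply pow_incr; lra].
    + replace (Z.pred n + 1 + Z.of_nat (S i))%Z with (n + 1 + Z.of_nat i)%Z by lia.
      eapply Rle_trans; [apply HD|]. apply Rmult_le_compat_r; [exact P2|].
      assert (P1 : (0 <= (2 * (M + 1)) ^ S i)%R) by (apply pow_le; lra).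
      apply Rle_trans with (D / (2 * (M + 1)) * (2 * (M + 1)) ^ S i)%R.
      * apply Req_le. simpl. field. lra.
      * apply Rmult_le_compat_r; lra. }
intros n. destruct (HP (n - 1)%Z) as [D [HD0 HD]]. exists D. split; [exact HD0|].
intros i d. specialize (HD i d). now replace (n - 1 + 1)%Z with n in HD by lia.
Qed.

End PowerMatrixBound.

(** * Composition *)

Lemma pow_n_Cpow (z : C) (k : nat) : @pow_n C_Ring z k = Cpow z k.
Proof.
induction k as [|k IH]; [reflexivity|].
simpl. rewrite <- IH. reflexivity.
Qed.

Lemma is_pseries_cseries (c : nat -> C) (z l : C) :
  @is_pseries C_AbsRing C_NormedModule c z l <-> cseries (fun k => c k * Cpow z k) l.
Proof.
unfold is_pseries. split; apply is_series_ext; intros k;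
rewrite <- (pow_n_Cpow z k); [|symmetry]; exact (Cmult_comm (@pow_n C_Ring z k) (c k)).
Qed.

Lemma cseries_at_0 (c : nat -> C) : cseries (fun k => c k * Cpow 0 k) (c O).
Proof.
apply cseries_le with (fun _ => 0%R); [|apply is_lim_seq_const].
intros n. rewrite csum_single_first.
- simpl. replace (_ - _) with (RtoC 0) by ring. rewrite Cmod_0. lra.
- intros k Hk. destruct k; [lia|]. rewrite Cpow_S. ring.
Qed.

Lemma taylor_bound (f : C -> C) (h : nat -> C) :
  is_taylor f h -> f 0 = 0 ->
  h O = 0 /\ exists c b r : R, (0 <= c)%R /\ (0 < b)%R /\ (0 < r)%R /\
    (forall j, (Cmod (h (S j)) <= c * b ^ j)%R) /\
    forall z, (Cmod z < r)%R -> cseries (fun j => h j * Cpow z j) (f z).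
Proof.
intros [r [Hr H]] Hf.
assert (HS : forall z, (Cmod z < r)%R -> cseries (fun j => h j * Cpow z j) (f z)).
{ intros z Hz. now apply is_pseries_cseries, H. }
split.
- rewrite <- Hf. apply cseries_unique with (1 := cseries_at_0 h), HS. now rewrite Cmod_0.
- assert (E : (Cmod (RtoC (r / 2)) = r / 2)%R) by (rewrite Cmod_R, Rabs_pos_eq; lra).
  destruct (cseries_coeff_bound h (RtoC (r / 2)) _ ltac:(apply Cmod_gt_0; rewrite E; lra)
    (HS (RtoC (r / 2)) ltac:(rewrite E; lra))) as [M [HM0 HM]].
  rewrite E in HM.
  assert (Hb : (0 < / (r / 2))%R) by (apply Rinv_0_lt_compat; lra).
  exists (M * / (r / 2))%R, (/ (r / 2))%R, r.
  split; [apply Rmult_le_pos; lra|]. split; [exact Hb|]. split; [exact Hr|]. split; [|exact HS].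
  intros j. eapply Rle_trans; [apply HM|]. apply Req_le. simpl. ring.
Qed.

Lemma ex_cderive_continuous (f : C -> C) (z0 : C) :
  @ex_derive C_AbsRing C_NormedModule f z0 ->
  forall eps : R, (0 < eps)%R -> exists d : R, (0 < d)%R /\
    forall z, (Cmod (z - z0) < d)%R -> (Cmod (f z - f z0) < eps)%R.
Proof.
intros H eps He.
pose proof (@ex_derive_continuous C_AbsRing C_NormedModule f z0 H) as HC.
pose proof (proj1 (@filterlim_locally_ball_norm C_AbsRing _ C_NormedModule _ _ f (f z0)) HC
  (mkposreal eps He)) as [d Hd].
exists d. split; [apply cond_pos|]. intros z Hz. exact (Hd z Hz).
Qed.

(** With y(s) the diagonal entry of exp(-s<h>) in row i, y' = -y (i h_1) and y(0) = 1, so the lower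
    bound for linear equations keeps y away from 0. *)
Lemma diag_neq_0 (h : nat -> C) (c b T : R) (i : Z) :
  (0 <= c)%R -> (0 < b)%R -> (forall j, (Cmod (h (S j)) <= c * b ^ j)%R) ->
  (0 <= T)%R -> exp_entry h (- T) i 0 <> 0.
Proof.
intros Hc Hb Hh HT E.
pose proof (Cmod_lower_bound (fun s => exp_entry h (- s) i 0) (fun _ => entry (angle h) i 0) 0 T HT) as L.
specialize (L ltac:(
  intros s _; eapply is_cderive_eq;
  [|apply (is_cderive_comp (fun y => exp_entry h y i 0) Ropp s (-1)%R);
    [now apply (exp_entry_derive h c b) | auto_derive; trivial; ring]];
  rewrite sum_O, Z.add_0_r; change (RtoC (-1)) with (RtoC (- (1)));
  rewrite RtoC_opp; simpl; ring)).
specialize (L _ (fun _ _ => Rle_refl _)). cbv beta in L.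
rewrite E, Cmod_0, Ropp_0, (exp_entry_0 h c b Hc Hb Hh), entry_one in L.
simpl in L. rewrite Cmod_1, Rmult_1_r in L.
pose proof (exp_pos (- (Cmod (entry (angle h) i 0) * (T - 0)))). lra.
Qed.

(** L is an iterated sum: powers of f(z), each expanded in powers of z. Regrouping by powers of z
    produces the matrix product. *)
Lemma product_series (h : nat -> C) (c b T ra : R) (f : C -> C) (A : zmatrix) :
  (0 <= c)%R -> (0 < b)%R -> (forall j, (Cmod (h (S j)) <= c * b ^ j)%R) ->
  (0 <= T)%R -> (0 < ra)%R ->
  (forall (n : Z) (z : C), (0 < Cmod z < ra)%R ->
     cseries (fun j => A n (n + Z.of_nat j)%Z * Cpowz z (n + Z.of_nat j)) (Cpowz (f z) n)) ->
  exists r : R, (0 < r)%R /\ forall (n : Z) (z : C) (L : C), (0 < Cmod z < r)%R ->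
    cseries (fun i => exp_entry h (- T) n i * Cpowz (f z) (n + Z.of_nat i)) L ->
    cseries (fun j =>
      entry (zm_mul (zm_exp (zm_scal (RtoC (- T)) (angle h))) A) n j * Cpowz z (n + Z.of_nat j)) L.
Proof.
intros Hc Hb Hh HT Hra HA.
destruct (power_matrix_bound f A ra Hra HA) as [S [Q [HS [HQ HB]]]].
set (R0 := (2 * b * exp (2 * c * T))%R).
assert (HR0 : (0 < R0)%R) by (unfold R0; pose proof (exp_pos (2 * c * T)); nra).
(* One ratio for both directions: R0 S governs the growth in i, Q the growth in d. *)
set (q := (R0 * S + Q)%R).
assert (Hq : (0 < q)%R) by (unfold q; nra).
exists (Rmin ra (/ 4 * / q))%R. split.
{ apply Rmin_pos; [exact Hra|]. apply Rmult_lt_0_compat; [lra | now apply Rinv_0_lt_compat]. }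
intros n z L Hz HL.
assert (Hz1 : (Cmod z < ra)%R) by (eapply Rlt_le_trans; [apply Hz | apply Rmin_l]).
assert (Hz2 : (q * Cmod z <= / 4)%R).
{ replace (/ 4)%R with (q * (/ 4 * / q))%R by (field; lra).
  apply Rmult_le_compat_l; [lra|]. left. eapply Rlt_le_trans; [apply Hz | apply Rmin_r]. }
assert (Hz0 : z <> 0) by (apply Cmod_gt_0; lra).
destruct (HB n) as [D [HD0 HD]].
set (g := exp (2 * c * Rabs (IZR n) * T)).
assert (Hg : (0 < g)%R) by apply exp_pos.
apply cseries_ext with (fun j => csum (fun i => exp_entry h (- T) n i *
  (A (n + Z.of_nat i)%Z (n + Z.of_nat i + Z.of_nat (j - i))%Z *
     Cpowz z (n + Z.of_nat i + Z.of_nat (j - i)))) j).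
{ intros j. rewrite entry_mul, <- csum_mult_r. apply sum_n_ext_loc. intros i Hi.
  unfold exp_entry. unfold entry at 3.
  replace (n + Z.of_nat i + Z.of_nat (j - i))%Z with (n + Z.of_nat j)%Z by lia. cring. }
apply (cseries_double (exp_entry h (- T) n)
  (fun i d => A (n + Z.of_nat i)%Z (n + Z.of_nat i + Z.of_nat d)%Z *
     Cpowz z (n + Z.of_nat i + Z.of_nat d))
  (fun i => Cpowz (f z) (n + Z.of_nat i)) L (g * D * Cmod (Cpowz z n)) (q * Cmod z)).
- repeat apply Rmult_le_pos; try lra. apply Cmod_ge_0.
- split; [apply Rmult_le_pos; lra | exact Hz2].
- intros i d. rewrite !Cpowz_add, !Cpowz_of_nat, !Cmod_mult, !Cmod_pow by exact Hz0.
  assert (E1 : (Cmod (exp_entry h (- T) n i) <= g * R0 ^ i)%R).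
  { apply (exp_entry_geometric_bound h c b Hc Hb Hh). rewrite Rabs_Ropp, Rabs_pos_eq; lra. }
  specialize (HD i d). unfold entry in HD.
  assert (P : forall y e, (0 <= y)%R -> (0 <= y ^ e)%R) by (intros; now apply pow_le).
  assert (PS : forall e, (R0 ^ e * S ^ e <= q ^ e)%R).
  { intros e. rewrite <- Rpow_mult_distr. apply pow_incr. unfold q. nra. }
  assert (PQ : forall e, (Q ^ e <= q ^ e)%R).
  { intros e. apply pow_incr. unfold q. nra. }
  pose proof (Cmod_ge_0 z) as Z0. pose proof (Cmod_ge_0 (Cpowz z n)) as Z1.
  apply Rle_trans with ((g * R0 ^ i) * ((D * S ^ i * Q ^ d) * (Cmod (Cpowz z n) * Cmod z ^ i * Cmod z ^ d)))%R.
  + apply Rmult_le_compat; trivial; [apply Cmod_ge_0| |].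
    * apply Rmult_le_pos; [apply Cmod_ge_0|]. repeat apply Rmult_le_pos; auto.
    * apply Rmult_le_compat_r; [|exact HD]. repeat apply Rmult_le_pos; auto.
  + rewrite !Rpow_mult_distr.
    replace ((g * R0 ^ i) * ((D * S ^ i * Q ^ d) * (Cmod (Cpowz z n) * Cmod z ^ i * Cmod z ^ d)))%R
      with ((g * D * Cmod (Cpowz z n) * (Cmod z ^ i * Cmod z ^ d)) * ((R0 ^ i * S ^ i) * Q ^ d))%R by ring.
    replace (g * D * Cmod (Cpowz z n) * (q ^ i * Cmod z ^ i) * (q ^ d * Cmod z ^ d))%R
      with ((g * D * Cmod (Cpowz z n) * (Cmod z ^ i * Cmod z ^ d)) * (q ^ i * q ^ d))%R by ring.
    apply Rmult_le_compat_l.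
    * repeat apply Rmult_le_pos; auto; lra.
    * apply Rmult_le_compat; auto; try (apply P; lra).
      apply Rmult_le_pos; apply P; lra.
- intros i. apply HA. lra.
- exact HL.
Qed.

Lemma loewner_powers (p w0 : C -> C) (h : nat -> C) (a : R) (w : R -> C -> C) (t c b rh : R) :
  holomorphic_on_disc p ->
  (forall z : C, in_disc z -> (0 < Re (p z))%R) ->
  univalent_on_disc w0 -> w0 0 = 0 ->
  loewner_solution p a w0 w -> (a <= t)%R ->
  (0 <= c)%R -> (0 < b)%R -> (0 < rh)%R -> h O = 0 ->
  (forall j, (Cmod (h (S j)) <= c * b ^ j)%R) ->
  (forall z, (Cmod z < rh)%R -> cseries (fun j => h j * Cpow z j) (z * p z)) ->
  exists r : R, (0 < r)%R /\ forall (n : Z) (z : C), (0 < Cmod z < r)%R ->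
    cseries (fun i => exp_entry h (- (t - a)) n i * Cpowz (w a z) (n + Z.of_nat i))
      (Cpowz (w t z) n).
Proof.
intros Hp Hre [Hw0 Hinj] Hw00 [Hwa [Hwd Hwt]] Hat Hc Hb Hrh Hh0 Hh Hser.
assert (D0 : in_disc 0) by (unfold in_disc; rewrite Cmod_0; lra).
destruct (ex_cderive_continuous p 0 (Hp 0 D0) 1 ltac:(lra)) as [dp [Hdp Hp1]].
set (P := (Cmod (p 0) + 1)%R).
assert (HP0 : (0 <= P)%R) by (unfold P; pose proof (Cmod_ge_0 (p 0)); lra).
assert (HP : forall z, (Cmod z < dp)%R -> (Cmod (p z) <= P)%R).
{ intros z Hz. replace (p z) with ((p z - p 0) + p 0) by ring.
  eapply Rle_trans; [apply Cmod_triangle|]. unfold P.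
  specialize (Hp1 z). replace (z - 0) with z in Hp1 by ring. specialize (Hp1 Hz). lra. }
set (r := (2 * b * exp (2 * c * (t - a)))%R).
assert (Hr : (0 < r)%R) by (unfold r; pose proof (exp_pos (2 * c * (t - a))); nra).
(* The cap on |u(a)|, hence on |u| afterwards: rh for the series of h, dp for the bound on p, 1 and
   1/(8r) for [flow_powers]. *)
set (x0 := Rmin (Rmin rh dp) (Rmin 1 (/ 8 * / r))).
assert (Hx0 : (0 < x0)%R).
{ unfold x0. repeat apply Rmin_pos; trivial; [lra|].
  apply Rmult_lt_0_compat; [lra | now apply Rinv_0_lt_compat]. }
assert (Hx1 : (x0 <= rh)%R) by (unfold x0; eapply Rle_trans; [apply Rmin_l | apply Rmin_l]).
assert (Hx2 : (x0 <= dp)%R) by (unfold x0; eapply Rle_trans; [apply Rmin_l | apply Rmin_r]).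
assert (Hx3 : (x0 <= 1)%R) by (unfold x0; eapply Rle_trans; [apply Rmin_r | apply Rmin_l]).
assert (Hx4 : (x0 <= / 8 * / r)%R) by (unfold x0; eapply Rle_trans; [apply Rmin_r | apply Rmin_r]).
destruct (ex_cderive_continuous w0 0 (Hw0 0 D0) x0 Hx0) as [dw [Hdw Hw1]].
exists (Rmin 1 dw). split; [apply Rmin_pos; lra|].
intros n z Hz.
assert (Dz : in_disc z) by (unfold in_disc; eapply Rlt_le_trans; [apply Hz | apply Rmin_l]).
assert (Hz2 : (Cmod z < dw)%R) by (eapply Rlt_le_trans; [apply Hz | apply Rmin_r]).
destruct (is_cderive_extension (fun s => w s z) (fun s => - (w s z * p (w s z))) a
  (fun s Hs => Hwt s z Hs Dz)) as [u [Hu Hdu]].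
assert (Hua : (0 < Cmod (u a) < x0)%R).
{ rewrite Hu, Hwa by (trivial; lra). split.
  (* Injectivity of w0 together with w0(0) = 0 makes the trajectory start away from 0. *)
  - apply Cmod_gt_0. intros E. rewrite <- Hw00 in E. apply Hinj in E; trivial.
    rewrite E, Cmod_0 in Hz. lra.
  - specialize (Hw1 z). rewrite Hw00 in Hw1.
    replace (z - 0) with z in Hw1 by ring. replace (w0 z - 0) with (w0 z) in Hw1 by ring.
    now apply Hw1. }
assert (Hdu' : forall s, (a <= s)%R -> is_cderive u s (- (u s * p (u s)))).
{ intros s Hs. rewrite Hu by exact Hs. now apply Hdu. }
assert (Hup : forall s, (a <= s <= t)%R -> (Cmod (u s) <= Cmod (u a))%R).
{ intros s [Hs1 Hs2]. apply (Cmod_nonincreasing u (fun s => p (u s)) a s Hs1).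
  - intros y Hy. apply Hdu'. lra.
  - intros y Hy. left. apply Hre. rewrite Hu by lra. apply Hwd; trivial; lra. }
assert (Hlow : forall s, (a <= s <= t)%R -> (exp (- (P * (t - a))) * Cmod (u a) <= Cmod (u s))%R).
{ intros s [Hs1 Hs2].
  eapply Rle_trans; [|apply (Cmod_lower_bound u (fun s => p (u s)) a s Hs1 (fun y Hy => Hdu' y (proj1 Hy)) P)].
  - apply Rmult_le_compat_r; [lra|]. apply exp_le_compat. apply Ropp_le_contravar.
    apply Rmult_le_compat_l; lra.
  - intros y Hy. apply HP. specialize (Hup y ltac:(lra)). lra. }
rewrite <- (Hu a), <- (Hu t) by lra.
replace (- (t - a))%R with (a - t)%R by ring.
apply (flow_powers h c b Hc Hb Hh Hh0 u (fun s => u s * p (u s)) a t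
  (exp (- (P * (t - a))) * Cmod (u a)) (Cmod (u a)) Hat).
- apply Rmult_lt_0_compat; [apply exp_pos | lra].
- intros s Hs. apply Hdu'. lra.
- intros s Hs. apply Hser. specialize (Hup s Hs). lra.
- intros s Hs. split; [now apply Hlow | now apply Hup].
- fold r. replace (/ 8)%R with (r * (/ 8 * / r))%R by (field; lra).
  apply Rmult_le_compat_l; lra.
- lra.
Qed.

(** The modulus of w_t(0) cannot increase from its initial value 0. *)
Lemma loewner_fixes_0 (p w0 : C -> C) (a t : R) (w : R -> C -> C) :
  (forall z : C, in_disc z -> (0 < Re (p z))%R) -> w0 0 = 0 ->
  loewner_solution p a w0 w -> (a <= t)%R -> w t 0 = 0.
Proof.
intros Hre Hw00 [Hwa [Hwd Hwt]] Hat.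
assert (D0 : in_disc 0) by (unfold in_disc; rewrite Cmod_0; lra).
destruct (is_cderive_extension (fun s => w s 0) (fun s => - (w s 0 * p (w s 0))) a
  (fun s Hs => Hwt s 0 Hs D0)) as [u [Hu Hdu]].
rewrite <- Hu by exact Hat.
apply Cmod_eq_0, Rle_antisym; [|apply Cmod_ge_0].
rewrite <- Cmod_0, <- Hw00, <- Hwa, <- (Hu a) by (trivial; lra).
apply (Cmod_nonincreasing u (fun s => p (u s)) a t Hat).
- intros s [Hs _]. rewrite Hu by exact Hs. now apply Hdu.
- intros s [Hs _]. left. apply Hre. rewrite Hu by exact Hs. now apply Hwd.
Qed.

(** Row 1 expands f off 0 only and starts at z^1; the value at 0 and the missing constant term come
    from f(0) = 0 and triangularity. *)
Lemma power_matrix_taylor (f : C -> C) (M : zmatrix) :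
  is_power_matrix f M -> is_taylor f (fun k => M 1%Z (Z.of_nat k)).
Proof.
intros [Hf [_ [Htri [r [Hr H]]]]]. exists r. split; [exact Hr|].
assert (H10 : M 1%Z (Z.of_nat 0) = 0) by (apply Htri; lia).
intros z Hz. apply is_pseries_cseries.
destruct (Ceq_dec z 0) as [-> | Hz0].
- replace (f 0) with (M 1%Z (Z.of_nat 0)) by (rewrite Hf; exact H10).
  apply (cseries_at_0 (fun k => M 1%Z (Z.of_nat k))).
- apply (@is_series_decr_1 C_AbsRing C_NormedModule).
  replace (plus (f z) _) with (f z).
  2:{ rewrite H10. change (f z = f z + - (0 * Cpow z 0)). ring. }
  apply Cmod_gt_0 in Hz0. specialize (H 1%Z z (conj Hz0 Hz)).
  change (Cpowz (f z) 1) with (Cpow (f z) 1) in H. rewrite Cpow_1_r in H.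
  revert H. apply cseries_ext. intros j.
  replace (1 + Z.of_nat j)%Z with (Z.of_nat (S j)) by lia. now rewrite Cpowz_of_nat.
Qed.

Theorem theorem4p2 :
  forall (p : C -> C) (h : nat -> C)
         (a : R) (w0 : C -> C) (d : R) (w : R -> C -> C) (Wa : zmatrix),
  holomorphic_on_disc p ->
  (forall z : C, in_disc z -> (0 < Re (p z))%R) ->
  is_taylor (fun z : C => z * p z) h ->
  univalent_on_disc w0 ->
  (forall z : C, in_disc z -> in_disc (w0 z)) ->
  w0 0 = 0 ->
  @is_derive C_AbsRing C_NormedModule w0 (RtoC 0) (RtoC d) ->
  (0 < d < 1)%R ->
  loewner_solution p a w0 w ->
  is_power_matrix (w a) Wa ->
  forall t : R, (a <= t)%R ->
    let M := zm_mul (zm_exp (zm_scal (RtoC (- (t - a))) (angle h))) Wa in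
    is_power_matrix (w t) M /\
    exists c : nat -> C,
      is_taylor (w t) c /\ c O = 0 /\
      forall n k : nat, (1 <= k <= n)%nat ->
        c k = coeff_mat (RtoC 0) (principal_block 1 (Z.of_nat n) M) 0 (k - 1).
Proof.
intros p h a w0 d w Wa Hp Hre Hh Hw0 _ Hw00 _ _ Hw [_ [Hd1 [_ [ra [Hra HA]]]]] t Hat M.
destruct (taylor_bound _ h Hh (Cmult_0_l _)) as [Hh0 [c [b [rh [Hc [Hb [Hrh [Hhb Hser]]]]]]]].
destruct (loewner_powers p w0 h a w t c b rh Hp Hre Hw0 Hw00 Hw Hat Hc Hb Hrh Hh0 Hhb Hser)
  as [r1 [Hr1 H1]].
destruct (product_series h c b (t - a) ra (w a) Wa Hc Hb Hhb ltac:(lra) Hra HA)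
  as [r2 [Hr2 H2]].
assert (HM : is_power_matrix (w t) M).
{ split; [|split; [|split]].
  - exact (loewner_fixes_0 p w0 a t w Hre Hw00 Hw Hat).
  - change (M 1%Z 1%Z) with (entry M 1 0). unfold M. rewrite entry_mul, sum_O.
    apply Cmult_neq_0; [|exact Hd1].
    apply (diag_neq_0 h c b); trivial. lra.
  - intros n k Hnk. unfold M, zm_mul. now rewrite (proj2 (Z.leb_gt _ _)).
  - exists (Rmin r1 r2). split; [now apply Rmin_pos|].
    intros n z Hz. pose proof (Rmin_l r1 r2). pose proof (Rmin_r r1 r2).
    apply H2; [lra|]. apply H1. lra. }
split; [exact HM|].
exists (fun k => M 1%Z (Z.of_nat k)). split; [now apply power_matrix_taylor|]. split.
- destruct HM as [_ [_ [Htri _]]]. apply Htri. lia.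
(* The block is renumbered from 0, so row 1 and column k of M sit at 0 and k - 1. *)
- intros n k Hk. unfold principal_block. rewrite coeff_mat_bij by lia. f_equal. lia.
Qed.
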